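(* Let $k$ be a commutative ring with $\mathbb{Q}\subset k$, $A$ a commutative $k$-algebra, $R$ a $k$-algebra over $A$, and $\nabla:\mathrm{Der}_k(A)\to R$ an LR-admissible map. Then there is a unique HS-structure $\Psi=\{\Psi^p_\Delta\}$ on $R$ over $A/k$ such that for each $p\ge 1$, each non-empty co-ideal $\Delta\subset\mathbb{N}^p$ and each $D\in\mathrm{HS}^p_k(A;\Delta)$ one has $$\varepsilon\big(\Psi^p_\Delta(D)\big)=\overline{\nabla}\big(\varepsilon(D)\big)\quad\text{in }R[[\mathbf{s}]]_{\Delta,+},$$ where $\mathbf{s}=\{s_1,\dots,s_p\}$ and $\overline{\nabla}:\mathrm{Der}_k(A)[[\mathbf{s}]]_{\Delta,+}\to R[[\mathbf{s}]]_{\Delta,+}$ is the left $A[[\mathbf{s}]]_\Delta$-linear map $\overline{\nabla}\left(\sum\delta_\alpha\mathbf{s}^\alpha\right)=\sum\nabla(\delta_\alpha)\mathbf{s}^\alpha$. Moreover, if $R=\bigcup_{d\ge 0}R_d$ is a filtered $k$-algebra over $A$ and $\operatorname{Im}\nabla\subset R_1$, then $\Psi$ is a filtered HS-structure.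
   Context: Throughout, $k$ is a commutative ring and $A$ a commutative $k$-algebra; $\mathbb{N}=\{0,1,2,\dots\}$; $\mathbf{s}=\{s_1,\dots,s_p\}$, $\mathbf{t}=\{t_1,\dots,t_q\}$ are sets of variables (for $p=1$ the variable is written $s$). Co-ideals and truncated series. $\mathbb{N}^p$ has the componentwise partial order and $|\alpha|=\alpha_1+\cdots+\alpha_p$. A co-ideal of $\mathbb{N}^p$ is a subset $\Delta$ such that $\alpha\in\Delta$, $\alpha'\le\alpha$ imply $\alpha'\in\Delta$. For an abelian group $M$ and a non-empty co-ideal $\Delta$, $M[[\mathbf{s}]]_\Delta$ is the quotient of $M[[\mathbf{s}]]$ by the series with $m_\alpha=0$ for all $\alpha\in\Delta$; its elements are written $\sum_{\alpha\in\Delta}m_\alpha\mathbf{s}^\alpha$. $M[[\mathbf{s}]]_{\Delta,+}$ is the subgroup of those with $m_0=0$. If $R$ is a ring, $R[[\mathbf{s}]]_\Delta$ is a ring (the variables are central), and $\mathcal{U}^p(R;\Delta)$ is the multiplicative group of $r\in R[[\mathbf{s}]]_\Delta$ with $r_0=1$; the inverse of $r$ is denoted $r^*$. A $k$-algebra over $A$ is a not necessarily commutative $k$-algebra $R$ with a $k$-algebra map $\iota:A\to R$; elements of $A$ act on $R$ on both sides through $\iota$, and $a\in A$ is also written for $\iota(a)$. It is filtered if it carries an (increasing, exhaustive) ring filtration $(R_d)_{d\ge 0}$ with $\iota(A)\subset R_0$. Substitution maps. A substitution map $\varphi:A[[\mathbf{s}]]_\Delta\to A[[\mathbf{t}]]_\Omega$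 (with $\Delta\subset\mathbb{N}^p$, $\Omega\subset\mathbb{N}^q$ non-empty co-ideals) is an $A$-algebra map such that each $\varphi(s_i)$ has zero constant term. For $r=\sum r_\alpha\mathbf{s}^\alpha\in R[[\mathbf{s}]]_\Delta$, $\varphi\bullet r:=\sum_\alpha\varphi(\mathbf{s}^\alpha)r_\alpha\in R[[\mathbf{t}]]_\Omega$. Hasse–Schmidt derivations. $\mathrm{HS}^p_k(A;\Delta)$ is the set of families $D=(D_\alpha)_{\alpha\in\Delta}$ of $k$-linear maps $D_\alpha:A\to A$ with $D_0=\mathrm{Id}$ and $D_\alpha(xy)=\sum_{\beta+\gamma=\alpha}D_\beta(x)D_\gamma(y)$. Identifying $D$ with $\sum_{\alpha\in\Delta}D_\alpha\mathbf{s}^\alpha$, it is a subgroup of $\mathcal{U}^p(\mathrm{End}_k(A);\Delta)$, and $\varphi\bullet D\in\mathrm{HS}^q_k(A;\Omega)$ for every substitution map $\varphi:A[[\mathbf{s}]]_\Delta\to A[[\mathbf{t}]]_\Omega$ with $\Delta\subset\mathbb{N}^p$, $\Omega\subset\mathbb{N}^q$ non-empty co-ideals (known). HS-structures. An HS-structure on a $k$-algebra $R$ over $A$ (over $A/k$) is a system of maps $\Psi^p_\Delta:\mathrm{HS}^p_k(A;\Delta)\to\mathcal{U}^p(R;\Delta)$, for $p\in\mathbb{N}$ and $\Delta\subset\mathbb{N}^p$ a non-empty co-ideal (for $p=0$ the groups are trivial), such that: (i) each $\Psi^p_\Delta$ is a group homomorphism; (ii) $\Psi^p_\Delta(D)\,a=\left(\sum_{\alpha\in\Delta}D_\alpha(a)\mathbf{s}^\alpha\right)\Psi^p_\Delta(D)$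 for all $D\in\mathrm{HS}^p_k(A;\Delta)$, $a\in A$; (iii) $\Psi^q_\Omega(\varphi\bullet D)=\varphi\bullet\Psi^p_\Delta(D)$ for every substitution map $\varphi:A[[\mathbf{s}]]_\Delta\to A[[\mathbf{t}]]_\Omega$ and every $D\in\mathrm{HS}^p_k(A;\Delta)$. If $R$ is filtered, $\Psi$ is called filtered if the coefficient $\Psi^p_\Delta(D)_\alpha$ lies in $R_{|\alpha|}$ for all $p$, $\Delta$, $D\in\mathrm{HS}^p_k(A;\Delta)$ and $\alpha\in\Delta$. LR-admissible maps. A map $\nabla:\mathrm{Der}_k(A)\to R$ is LR-admissible if it is left $A$-linear, $\nabla(\delta)a=a\nabla(\delta)+\delta(a)1_R$, and $\nabla([\delta,\delta'])=[\nabla(\delta),\nabla(\delta')]$ for all $\delta,\delta'\in\mathrm{Der}_k(A)$, $a\in A$. The map $\varepsilon$. For a ring $R$ and $r=\sum r_\alpha\mathbf{s}^\alpha\in\mathcal{U}^p(R;\Delta)$, $\varepsilon(r):=r^*\,\boldsymbol\chi(r)\in R[[\mathbf{s}]]_{\Delta,+}$, where $\boldsymbol\chi\left(\sum_\alpha r_\alpha\mathbf{s}^\alpha\right)=\sum_\alpha|\alpha|\,r_\alpha\mathbf{s}^\alpha$. For $D\in\mathrm{HS}^p_k(A;\Delta)\subset\mathcal{U}^p(\mathrm{End}_k(A);\Delta)$ it is known that $\varepsilon(D)\in\mathrm{Der}_k(A)[[\mathbf{s}]]_{\Delta,+}$. When $\mathbb{Q}\subset k$, it is known that $\varepsilon:\mathcal{U}^p(R;\Delta)\to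 R[[\mathbf{s}]]_{\Delta,+}$ (for $R$ a $k$-algebra) and $\varepsilon:\mathrm{HS}^p_k(A;\Delta)\to\mathrm{Der}_k(A)[[\mathbf{s}]]_{\Delta,+}$ are bijective. *)

(* Defs.v *)
From HB Require Import structures.
From mathcomp Require Import all_boot all_order all_algebra.
From mathcomp Require Import boolp classical_sets.
From mathcomp Require Import mpoly.

Set Implicit Arguments.
Unset Strict Implicit.
Unset Printing Implicit Defensive.

Import GRing.Theory.
Local Open Scope ring_scope.

(* Conventions.  Rings are MathComp's pzRingType, so that the zero ring is    *)
(* allowed; MathComp's algType would exclude it.  Accordingly a k-algebra is  *)
(* a ring with a ring morphism from k that has central image.  Multi-indices  *)
(* are multinomials alpha : 'X_{1..p}, |alpha| is mdeg alpha, and (_ <= _)%MM *)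
(* is the componentwise order.                                                *)

Record coideal (p : nat) := Coideal {
  coideal_set :> 'X_{1..p} -> Prop;
  coideal_down : forall a b : 'X_{1..p},
    (b <= a)%MM -> coideal_set a -> coideal_set b;
  coideal_neq0 : exists a, coideal_set a
}.

Lemma coideal0 p (Delta : coideal p) : Delta 0%MM.
Proof.
have [a Da] := coideal_neq0 Delta; apply: coideal_down Da.
by apply/mnm_lepP=> i; rewrite mnm0E.
Qed.

(* Every pair with b + c = a has |b|, |c| <= |a|, so the bounded sum runs     *)
(* over all decompositions of a.                                              *)
Definition msum p (M : nmodType) (a : 'X_{1..p})
    (F : 'X_{1..p} -> 'X_{1..p} -> M) : M :=
  \sum_(h : 'X_{1..p < (mdeg a).+1, (mdeg a).+1} | a == (h.1 + h.2)%MM)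
     F h.1 h.2.

Section MultiSum.
Variable p : nat.
Implicit Types (a b c : 'X_{1..p}) (M : nmodType).

Lemma sum_bnd M N1 N2 (P : pred 'X_{1..p}) (G : 'X_{1..p} -> M) :
  (forall b, P b -> (mdeg b < N1) && (mdeg b < N2))%N ->
  \sum_(b : 'X_{1..p < N1} | P b) G b = \sum_(b : 'X_{1..p < N2} | P b) G b.
Proof.
move=> bP.
have toseq N : \sum_(b : 'X_{1..p < N} | P b) G b =
    \sum_(b <- [seq m <- [seq bmnm i | i <- enum {: 'X_{1..p < N}}] | P m]) G b.
  by rewrite big_filter big_map big_enum_cond.
rewrite !toseq; apply: perm_big; apply: uniq_perm.
- by rewrite filter_uniq // map_inj_uniq ?enum_uniq //; apply: val_inj.
- by rewrite filter_uniq // map_inj_uniq ?enum_uniq //; apply: val_inj.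
have memE N m : P m -> (mdeg m < N)%N ->
    m \in [seq bmnm i | i <- enum {: 'X_{1..p < N}}].
  by move=> _ lt; apply/mapP; exists (BMultinom lt); rewrite ?mem_enum.
move=> m; rewrite !mem_filter; case Pm: (P m) => //=.
by have /andP[l1 l2] := bP _ Pm; rewrite !memE.
Qed.

Lemma msumE M N a (F : 'X_{1..p} -> 'X_{1..p} -> M) : (mdeg a < N)%N ->
  msum a F = \sum_(b : 'X_{1..p < N}) \sum_(c : 'X_{1..p < N})
    (if a == (b + c)%MM then F b c else 0).
Proof.
move=> aN; rewrite /msum big_mkcond -(pair_bigA _ (fun b c : 'X_{1..p < _} =>
  if a == (b + c)%MM then F b c else 0)) /=.
have le1 b c : a == (b + c)%MM -> (mdeg b <= mdeg a)%N && (mdeg c <= mdeg a)%N.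
  by move=> /eqP->; rewrite mdegD leq_addr leq_addl.
transitivity (\sum_(b : 'X_{1..p < (mdeg a).+1}) \sum_(c : 'X_{1..p < N} |
    a == (b + c)%MM) F b c).
  apply: eq_bigr => b _; rewrite -big_mkcond.
  apply: (sum_bnd (P := fun c => a == (b + c)%MM) (F b)) => c /le1/andP[_ lc].
  by rewrite ltnS lc (leq_ltn_trans lc).
transitivity (\sum_(b : 'X_{1..p < (mdeg a).+1} | (mdeg b <= mdeg a)%N)
    \sum_(c : 'X_{1..p < N} | a == (b + c)%MM) F b c).
  by apply: eq_bigl => b; rewrite -ltnS bmdeg.
rewrite (sum_bnd (N2 := N) (P := fun b => (mdeg b <= mdeg a)%N)
    (fun b => \sum_(c : 'X_{1..p < N} | a == (b + c)%MM) F b c)); last first.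
  by move=> b lb; rewrite ltnS lb (leq_ltn_trans lb).
rewrite big_mkcond; apply: eq_bigr => b _; rewrite -big_mkcond.
case: ifP => // nle; rewrite big1 // => c /le1 /andP[]; by rewrite nle.
Qed.

Lemma mdeg_lt_addl n a b c :
  a = (b + c)%MM -> b != 0%MM -> (mdeg a < n.+1)%N -> (mdeg c < n)%N.
Proof.
move=> -> b0; rewrite mdegD ltnS; apply: leq_trans.
by rewrite -add1n leq_add2r lt0n mdeg_eq0.
Qed.

Lemma eq_msum M a (F G : 'X_{1..p} -> 'X_{1..p} -> M) :
  (forall b c, a = (b + c)%MM -> F b c = G b c) -> msum a F = msum a G.
Proof. by move=> FG; apply: eq_bigr => h /eqP /FG. Qed.

Lemma msum_split M a (F G : 'X_{1..p} -> 'X_{1..p} -> M) :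
  msum a (fun b c => F b c + G b c) = msum a F + msum a G.
Proof. exact: big_split. Qed.

Lemma msumMn M a (F : 'X_{1..p} -> 'X_{1..p} -> M) n :
  msum a F *+ n = msum a (fun b c => F b c *+ n).
Proof. by rewrite /msum sumrMnl. Qed.

Lemma msum_morph (M M' : nmodType) (f : {additive M -> M'}) a F :
  f (msum a F) = msum a (fun b c => f (F b c)).
Proof. exact: raddf_sum. Qed.

Lemma msumC M a (F : 'X_{1..p} -> 'X_{1..p} -> M) :
  msum a F = msum a (fun b c => F c b).
Proof.
rewrite !(msumE _ (ltnSn _)) exchange_big; apply: eq_bigr => b _.
by apply: eq_bigr => c _; rewrite addmC.
Qed.

Lemma msumA M a (F : 'X_{1..p} -> 'X_{1..p} -> 'X_{1..p} -> M) :
  msum a (fun b e => msum b (fun c d => F c d e)) =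
  msum a (fun c f => msum f (fun d e => F c d e)).
Proof.
have [N aN0] : exists N, (mdeg a < N)%N by exists (mdeg a).+1.
have ltl b c : a = (b + c)%MM -> (mdeg b < N)%N && (mdeg c < N)%N.
  by move=> aE; rewrite !(leq_ltn_trans _ aN0) // aE mdegD ?leq_addr ?leq_addl.
pose T c d e := if a == (c + d + e)%MM then F c d e else 0.
transitivity (\sum_(c : 'X_{1..p < N}) \sum_(d : 'X_{1..p < N})
    \sum_(e : 'X_{1..p < N}) T c d e).
  rewrite (msumE _ aN0) exchange_big /=.
  under eq_bigr => e _.
    under eq_bigr => b _.
      rewrite (_ : (if _ then _ else _) = \sum_(c : 'X_{1..p < N})
        \sum_(d : 'X_{1..p < N}) (if (a == (b + e)%MM) && (val b == (c + d)%MM)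
          then F c d e else 0)); last first.
        case: ifP => [/eqP /ltl /andP[lb _]|_]; first by rewrite (msumE _ lb).
        by rewrite big1 // => c _; rewrite big1.
      over.
    rewrite exchange_big /=.
    under eq_bigr => c _ do rewrite exchange_big /=.
    over.
  rewrite exchange_big /=; apply: eq_bigr => c _.
  rewrite exchange_big /=; apply: eq_bigr => d _.
  apply: eq_bigr => e _; rewrite /T; case: ifP => [/eqP aE|aN].
    have /andP[lcd _] := ltl _ _ aE.
    rewrite (bigD1 (BMultinom lcd)) //= aE !eqxx /= big1 ?addr0 // => b.
    rewrite -(inj_eq val_inj) /= => /negPf ->; by rewrite andbF.
  by rewrite big1 // => b _; case: ifP => // /andP[/eqP aE /eqP bE];
     rewrite aE bE eqxx in aN.
symmetry; rewrite (msumE _ aN0); apply: eq_bigr => c _.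
under eq_bigr => f _.
  rewrite (_ : (if _ then _ else _) = \sum_(d : 'X_{1..p < N})
    \sum_(e : 'X_{1..p < N}) (if (a == (c + f)%MM) && (val f == (d + e)%MM)
      then F c d e else 0)); last first.
    case: ifP => [/eqP /ltl /andP[_ lf]|_]; first by rewrite (msumE _ lf).
    by rewrite big1 // => d _; rewrite big1.
  over.
rewrite exchange_big /=; apply: eq_bigr => d _.
rewrite exchange_big /=; apply: eq_bigr => e _.
rewrite /T; case: ifP => [/eqP|]; rewrite -addmA.
  move=> aE; have /andP[_ lde] := ltl _ _ aE.
  rewrite (bigD1 (BMultinom lde)) //= aE !eqxx /= big1 ?addr0 // => b.
  rewrite -(inj_eq val_inj) /= => /negPf ->; by rewrite andbF.
by move=> aN; rewrite big1 // => f _; case: ifP => // /andP[/eqP aE /eqP fE];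
   rewrite aE fE eqxx in aN.
Qed.

Lemma msumACA M a (F : 'X_{1..p} -> 'X_{1..p} -> 'X_{1..p} -> 'X_{1..p} -> M) :
  msum a (fun b e => msum b (fun b1 b2 => msum e (fun c d => F b1 b2 c d))) =
  msum a (fun u v => msum u (fun b1 c => msum v (fun b2 d => F b1 b2 c d))).
Proof.
rewrite (msumA a (fun b1 b2 e => msum e (fun c d => F b1 b2 c d))).
rewrite (msumA a (fun b1 c v => msum v (fun b2 d => F b1 b2 c d))).
apply: eq_msum => b1 f _.
rewrite -(msumA f (fun b2 c d => F b1 b2 c d)).
rewrite -(msumA f (fun c b2 d => F b1 b2 c d)).
by apply: eq_msum => g d _; rewrite msumC.
Qed.

Lemma msum0l M a (F : 'X_{1..p} -> 'X_{1..p} -> M) :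
  (forall b c, b != 0%MM -> F b c = 0) -> msum a F = F 0%MM a.
Proof.
move=> F0; have lt0 : (mdeg (0%MM : 'X_{1..p}) < (mdeg a).+1)%N by rewrite mdeg0.
rewrite (msumE _ (ltnSn _)) (bigD1 (BMultinom lt0)) //=.
rewrite (bigD1 (BMultinom (ltnSn (mdeg a)))) //= add0m eqxx.
rewrite [X in _ + X + _]big1 ?[X in _ + X]big1 ?addr0 //.
  move=> b; rewrite -(inj_eq val_inj) /= => b0; rewrite big1 // => c _.
  by rewrite F0 // if_same.
move=> c; rewrite -(inj_eq val_inj) /= add0m eq_sym.
by move=> /negPf ->.
Qed.

Lemma msum0r M a (F : 'X_{1..p} -> 'X_{1..p} -> M) :
  (forall b c, c != 0%MM -> F b c = 0) -> msum a F = F a 0%MM.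
Proof. by move=> F0; rewrite msumC msum0l // => b c; apply: F0. Qed.

Lemma msum_at0 M (F : 'X_{1..p} -> 'X_{1..p} -> M) :
  msum 0%MM F = F 0%MM 0%MM.
Proof.
transitivity (msum 0%MM (fun b c => if b == 0%MM then F b c else 0)).
  apply: eq_msum => b c /esym/eqP; rewrite mnmD_eq0 => /andP[/eqP-> _].
  by rewrite eqxx.
by rewrite msum0l ?eqxx // => b c /negPf ->.
Qed.

End MultiSum.

(* M[[s]]_Delta: an element is stored as its coefficient function extended by *)
(* 0 outside of Delta, and trunc is the quotient map M[[s]] -> M[[s]]_Delta.  *)
Record tseries p (Delta : coideal p) (M : nmodType) := TSeries {
  coef :> 'X_{1..p} -> M;
  coef_out : forall a, ~ Delta a -> coef a = 0
}.

Definition trunc p (Delta : coideal p) (M : nmodType) (f : 'X_{1..p} -> M) :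
  tseries Delta M.
Proof.
exists (fun a => if `[< Delta a >] then f a else 0).
by move=> a nDa; rewrite asboolF.
Defined.
Arguments trunc {p} Delta {M} f.
Arguments coef {p Delta M} t a : simpl never.

HB.instance Definition _ p (Delta : coideal p) (M : nmodType) :=
  gen_eqMixin (tseries Delta M).
HB.instance Definition _ p (Delta : coideal p) (M : nmodType) :=
  gen_choiceMixin (tseries Delta M).

Section TSeriesBasics.
Variables (p : nat) (Delta : coideal p).

Lemma truncE (M : nmodType) (f : _ -> M) a :
  trunc Delta f a = if `[< Delta a >] then f a else 0.
Proof. by []. Qed.

Lemma trunc_in (M : nmodType) (f : _ -> M) a : Delta a -> trunc Delta f a = f a.
Proof. by move=> Da; rewrite truncE asboolT. Qed.

Lemma tseriesP (M : nmodType) (r s : tseries Delta M) :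
  (forall a, Delta a -> r a = s a) -> r = s.
Proof.
move=> rs; have {rs} : coef r = coef s.
  apply/funext => a; have [/rs //|nDa] := pselect (Delta a).
  by rewrite !coef_out.
case: r s => [r r0] [s s0]; rewrite /coef => E; move: r0 s0; rewrite E => r0 s0.
by rewrite (Prop_irrelevance r0 s0).
Qed.

Lemma coideal_addl a b c : a = (b + c)%MM -> Delta a -> Delta b.
Proof. by move=> -> ; apply: coideal_down; apply: lem_addr. Qed.

Lemma coideal_addr a b c : a = (b + c)%MM -> Delta a -> Delta c.
Proof. by move=> -> ; apply: coideal_down; apply: lem_addl. Qed.

End TSeriesBasics.

Section TSeriesZmod.
Variables (p : nat) (Delta : coideal p) (M : zmodType).
Implicit Types r s t : tseries Delta M.

Definition tzero : tseries Delta M := trunc Delta (fun=> 0).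
Definition topp r : tseries Delta M := trunc Delta (fun a => - r a).
Definition tadd r s : tseries Delta M := trunc Delta (fun a => r a + s a).

Fact taddA : associative tadd.
Proof. by move=> r s t; apply: tseriesP => a Da; rewrite !trunc_in // addrA. Qed.
Fact taddC : commutative tadd.
Proof. by move=> r s; apply: tseriesP => a Da; rewrite !trunc_in // addrC. Qed.
Fact tadd0 : left_id tzero tadd.
Proof. by move=> r; apply: tseriesP => a Da; rewrite !trunc_in // add0r. Qed.
Fact taddN : left_inverse tzero topp tadd.
Proof. by move=> r; apply: tseriesP => a Da; rewrite !trunc_in // addNr. Qed.

HB.instance Definition _ :=
  GRing.isZmodule.Build (tseries Delta M) taddA taddC tadd0 taddN.

Lemma coef0 a : (0 : tseries Delta M) a = 0.
Proof. exact: if_same. Qed.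
Lemma coefD r s a : (r + s) a = r a + s a.
Proof.
have [Da|nDa] := pselect (Delta a); first exact: trunc_in.
by rewrite !coef_out // addr0.
Qed.
Lemma coefN r a : (- r) a = - r a.
Proof.
have [Da|nDa] := pselect (Delta a); first exact: trunc_in.
by rewrite !coef_out // oppr0.
Qed.
Lemma coefB r s a : (r - s) a = r a - s a.
Proof. by rewrite coefD coefN. Qed.
Lemma coef_sum I (e : seq I) (P : pred I) (F : I -> tseries Delta M) a :
  (\sum_(i <- e | P i) F i) a = \sum_(i <- e | P i) F i a.
Proof.
by apply: (big_morph (fun r => coef r a)) => [r s|]; rewrite ?coefD ?coef0.
Qed.

End TSeriesZmod.

Section TSeriesRing.
Variables (p : nat) (Delta : coideal p) (R : pzRingType).
Implicit Types r s t : tseries Delta R.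

Definition tone : tseries Delta R := trunc Delta (fun a => (a == 0%MM)%:R).
Definition tmul r s : tseries Delta R :=
  trunc Delta (fun a => msum a (fun b c => r b * s c)).

Fact tmulA : associative tmul.
Proof.
move=> r s t; apply: tseriesP => a Da; rewrite !trunc_in //.
transitivity (msum a (fun b f => msum f (fun c d => r b * (s c * t d)))).
  apply: eq_msum => b c aE; rewrite trunc_in; last exact: coideal_addr aE Da.
  by rewrite /msum mulr_sumr.
rewrite -(msumA a (fun b c d => r b * (s c * t d))).
apply: eq_msum => b c aE; rewrite trunc_in; last exact: coideal_addl aE Da.
rewrite /msum mulr_suml; by apply: eq_bigr => *; rewrite mulrA.
Qed.
Fact tmul1r : left_id tone tmul.
Proof.
move=> r; apply: tseriesP => a Da; rewrite trunc_in // msum0l /tone ?truncE.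
  by rewrite asboolT ?eqxx ?mul1r //; apply: coideal0.
by move=> b c /negPf b0; rewrite truncE b0 if_same mul0r.
Qed.
Fact tmulr1 : right_id tone tmul.
Proof.
move=> r; apply: tseriesP => a Da; rewrite trunc_in // msum0r /tone ?truncE.
  by rewrite asboolT ?eqxx ?mulr1 //; apply: coideal0.
by move=> b c /negPf c0; rewrite truncE c0 if_same mulr0.
Qed.
Fact tmulDl : left_distributive tmul +%R.
Proof.
move=> r s t; apply: tseriesP => a Da; rewrite coefD !trunc_in // -msum_split.
by apply: eq_msum => b c _; rewrite coefD mulrDl.
Qed.
Fact tmulDr : right_distributive tmul +%R.
Proof.
move=> r s t; apply: tseriesP => a Da; rewrite coefD !trunc_in // -msum_split.
by apply: eq_msum => b c _; rewrite coefD mulrDr.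
Qed.

HB.instance Definition _ := GRing.Zmodule_isPzRing.Build (tseries Delta R)
  tmulA tmul1r tmulr1 tmulDl tmulDr.

Lemma coefM r s a : Delta a -> (r * s) a = msum a (fun b c => r b * s c).
Proof. exact: trunc_in. Qed.
Lemma coef1 a : (1 : tseries Delta R) a = (a == 0%MM)%:R.
Proof.
have [Da|nDa] := pselect (Delta a); first exact: trunc_in.
rewrite coef_out //; case: eqP => // a0; case: nDa; rewrite a0.
exact: coideal0.
Qed.
Lemma coefM_at0 r s : (r * s) 0%MM = r 0%MM * s 0%MM.
Proof. by rewrite coefM ?msum_at0 //; apply: coideal0. Qed.

End TSeriesRing.

Fact tmulC p (Delta : coideal p) (A : comPzRingType) :
  commutative (@tmul p Delta A).
Proof.
move=> r s; apply: tseriesP => a Da; rewrite !trunc_in // msumC.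
by apply: eq_msum => *; rewrite mulrC.
Qed.
HB.instance Definition _ p (Delta : coideal p) (A : comPzRingType) :=
  GRing.PzRing_hasCommutativeMul.Build (tseries Delta A) (@tmulC p Delta A).

Definition tconst p (Delta : coideal p) (M : zmodType) (m : M) :
    tseries Delta M :=
  trunc Delta (fun a => m *+ (a == 0%MM)).
Arguments tconst {p} Delta {M} m.

Definition tmon p (Delta : coideal p) (R : pzRingType) (a : 'X_{1..p}) :
    tseries Delta R :=
  trunc Delta (fun b => (b == a)%:R).
Arguments tmon {p} Delta R a.

Definition tvar p (Delta : coideal p) (R : pzRingType) (i : 'I_p) :
    tseries Delta R :=
  tmon Delta R U_(i)%MM.
Arguments tvar {p} Delta R i.

Definition tmap p (Delta : coideal p) (M N : nmodType) (f : M -> N)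
    (r : tseries Delta M) : tseries Delta N :=
  trunc Delta (fun a => f (r a)).

Definition chi p (Delta : coideal p) (M : zmodType) (r : tseries Delta M) :
    tseries Delta M :=
  trunc Delta (fun a => r a *+ mdeg a).

Section TSeriesConst.
Variables (p : nat) (Delta : coideal p).

Lemma coef_const (M : zmodType) (m : M) a : tconst Delta m a = m *+ (a == 0%MM).
Proof.
have [Da|nDa] := pselect (Delta a); first exact: trunc_in.
rewrite coef_out //; case: eqP => // a0; case: nDa; rewrite a0.
exact: coideal0.
Qed.

Lemma coef_chi (M : zmodType) (r : tseries Delta M) a :
  chi r a = r a *+ mdeg a.
Proof.
have [Da|nDa] := pselect (Delta a); first exact: trunc_in.
by rewrite !coef_out // mul0rn.
Qed.

Lemma chiD (M : zmodType) (r s : tseries Delta M) : chi (r + s) = chi r + chi s.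
Proof.
by apply: tseriesP => a _; rewrite coefD !coef_chi coefD mulrnDl.
Qed.

Variable R : pzRingType.

Lemma coefMc (r : tseries Delta R) x a : (r * tconst Delta x) a = r a * x.
Proof.
have [Da|nDa] := pselect (Delta a); last by rewrite !coef_out // mul0r.
rewrite coefM // msum0r ?coef_const ?eqxx //.
by move=> b c /negPf c0; rewrite coef_const c0 mulr0.
Qed.

Lemma coefcM (r : tseries Delta R) x a : (tconst Delta x * r) a = x * r a.
Proof.
have [Da|nDa] := pselect (Delta a); last by rewrite !coef_out // mulr0.
rewrite coefM // msum0l ?coef_const ?eqxx //.
by move=> b c /negPf b0; rewrite coef_const b0 mul0r.
Qed.

Lemma tconst_is_zmod : zmod_morphism (@tconst p Delta R).
Proof.
by move=> x y; apply: tseriesP => a _; rewrite coefB !coef_const mulrnBl.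
Qed.
Lemma tconst_is_monoid : monoid_morphism (@tconst p Delta R).
Proof.
split=> [|x y]; apply: tseriesP => a _; first by [].
by rewrite coefMc !coef_const mulrnAl.
Qed.
HB.instance Definition _ :=
  GRing.isZmodMorphism.Build R (tseries Delta R) (tconst Delta) tconst_is_zmod.
HB.instance Definition _ :=
  GRing.isMonoidMorphism.Build R (tseries Delta R) (tconst Delta)
    tconst_is_monoid.

Lemma chiM (r s : tseries Delta R) : chi (r * s) = chi r * s + r * chi s.
Proof.
apply: tseriesP => a Da; rewrite coefD coef_chi !coefM // -msum_split.
rewrite msumMn; apply: eq_msum => b c ->.
by rewrite !coef_chi mdegD mulrnDr mulrnAl mulrnAr.
Qed.

End TSeriesConst.

Record useries p (Delta : coideal p) (R : pzRingType) := USeries {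
  useries_val :> tseries Delta R;
  useries_at0 : useries_val 0%MM = 1
}.

HB.instance Definition _ p (Delta : coideal p) (R : pzRingType) :=
  gen_eqMixin (useries Delta R).
HB.instance Definition _ p (Delta : coideal p) (R : pzRingType) :=
  gen_choiceMixin (useries Delta R).

Section USeriesGroup.
Variables (p : nat) (Delta : coideal p) (R : pzRingType).
Implicit Types r s t : useries Delta R.

Lemma useriesP r s : useries_val r = useries_val s -> r = s.
Proof.
case: r s => [r r1] [s s1] /= E; move: r1 s1; rewrite E => r1 s1.
by rewrite (Prop_irrelevance r1 s1).
Qed.

Fact uone_subproof : (1 : tseries Delta R) 0%MM = 1.
Proof. by rewrite coef1 eqxx. Qed.
Definition uone := USeries uone_subproof.

Fact umul_subproof r s : (useries_val r * useries_val s) 0%MM = 1.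
Proof. by rewrite coefM_at0 !useries_at0 mulr1. Qed.
Definition umul r s := USeries (umul_subproof r s).

Lemma coefX_small (n : tseries Delta R) j a :
  n 0%MM = 0 -> (mdeg a < j)%N -> (n ^+ j) a = 0.
Proof.
move=> n0; elim: j a => // j IHj a lt.
have [Da|nDa] := pselect (Delta a); last by rewrite coef_out.
rewrite exprS coefM // /msum big1 // => h /eqP aE.
have [->|h0] := eqVneq (h.1 : 'X_{1..p}) 0%MM; first by rewrite n0 mul0r.
by rewrite IHj ?mulr0 //; apply: mdeg_lt_addl aE h0 lt.
Qed.

(* r^* is the geometric series in 1 - r, finite in each degree.               *)
Definition uinv_val (r : tseries Delta R) : tseries Delta R :=
  trunc Delta (fun a => (\sum_(j < (mdeg a).+1) (1 - r) ^+ j) a).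

Lemma uinv_valE (r : tseries Delta R) N a : r 0%MM = 1 -> (mdeg a < N)%N ->
  uinv_val r a = (\sum_(j < N) (1 - r) ^+ j) a.
Proof.
move=> r1 aN; have [Da|nDa] := pselect (Delta a); last by rewrite !coef_out.
rewrite trunc_in // !coef_sum -(big_mkord xpredT (fun j => ((1 - r) ^+ j) a)).
rewrite -[RHS](big_mkord xpredT (fun j => ((1 - r) ^+ j) a)).
rewrite [RHS](@big_cat_nat _ _ _ (mdeg a).+1) //= [X in _ = _ + X]big1_seq ?addr0 //.
move=> j /andP[_]; rewrite mem_index_iota => /andP[lj _].
by apply: coefX_small => //; rewrite coefB coef1 eqxx r1 subrr.
Qed.

Lemma mul_uinv_val r : useries_val r * uinv_val r = 1.
Proof.
apply: tseriesP => a Da; have r1 := useries_at0 r.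
set S := \sum_(j < (mdeg a).+1) (1 - useries_val r) ^+ j.
transitivity ((useries_val r * S) a).
  rewrite !coefM //; apply: eq_msum => b c aE; rewrite (uinv_valE (N := (mdeg a).+1)) //.
  by rewrite ltnS aE mdegD leq_addl.
have -> : useries_val r * S = 1 - (1 - useries_val r) ^+ (mdeg a).+1.
  by rewrite -[RHS]opprB subrX1 addrAC subrr add0r mulNr opprK.
rewrite coefB coefX_small ?subr0 //.
by rewrite coefB coef1 eqxx r1 subrr.
Qed.

Fact uinv_subproof r : uinv_val r 0%MM = 1.
Proof.
have := congr1 (fun t : tseries Delta R => t 0%MM) (mul_uinv_val r).
by rewrite coefM_at0 useries_at0 mul1r coef1 eqxx.
Qed.
Definition uinv r := USeries (uinv_subproof r).

Fact umulA : associative umul.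
Proof. by move=> r s t; apply: useriesP; rewrite /= mulrA. Qed.
Fact umul1r : left_id uone umul.
Proof. by move=> r; apply: useriesP; rewrite /= mul1r. Qed.
Fact umulr1 : right_id uone umul.
Proof. by move=> r; apply: useriesP; rewrite /= mulr1. Qed.
Fact umulrV : right_inverse uone uinv umul.
Proof. by move=> r; apply: useriesP; apply: mul_uinv_val. Qed.
Fact umulVr : left_inverse uone uinv umul.
Proof.
move=> r; rewrite -[LHS]umulr1 -(umulrV (uinv r)) umulA -(umulA (uinv r)).
by rewrite umulrV umulr1.
Qed.

HB.instance Definition _ := isGroup.Build (useries Delta R)
  umulA umul1r umulr1 umulVr umulrV.

Lemma useries_mulE r s :
  useries_val (r * s)%g = useries_val r * useries_val s.
Proof. by []. Qed.
Lemma useries_oneE : useries_val (1 : useries Delta R)%g = 1.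
Proof. by []. Qed.

Definition eps r : tseries Delta R := useries_val (r^-1)%g * chi r.

Lemma eps_at0 r : eps r 0%MM = 0.
Proof. by rewrite coefM_at0 coef_chi mdeg0 mulr0n mulr0. Qed.

End USeriesGroup.

Record substmap p q (Delta : coideal p) (Omega : coideal q)
    (A : comPzRingType) := SubstMap {
  substmap_fun :> {rmorphism tseries Delta A -> tseries Omega A};
  substmap_alg : forall x : A, substmap_fun (tconst Delta x) = tconst Omega x;
  substmap_var : forall i : 'I_p, substmap_fun (tvar Delta A i) 0%MM = 0
}.

(* phi . r = \sum_a phi(s^a) r_a.  The coefficient of t^w is a finite sum     *)
(* since phi(s^a) has order at least |a|, see substmap_mon_small.             *)
Definition subst_act p q (Delta : coideal p) (Omega : coideal q)
    (A : comPzRingType) (R : pzRingType) (iota : A -> R)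
    (phi : substmap Delta Omega A) (r : tseries Delta R) : tseries Omega R :=
  trunc Omega (fun w =>
    \sum_(a : 'X_{1..p < (mdeg w).+1}) iota (phi (tmon Delta A a) w) * r a).

Section SubstTheory.
Variables (p q : nat) (Delta : coideal p) (Omega : coideal q).
Variables (A : comPzRingType) (phi : substmap Delta Omega A).

(* A series of order >= n with n > 0 is a sum of products s_i * g_i with g_i  *)
(* of order >= n - 1.                                                         *)
Lemma substmap_order n (f : tseries Delta A) :
  (forall a, (mdeg a < n)%N -> f a = 0) ->
  forall w, (mdeg w < n)%N -> phi f w = 0.
Proof.
elim: n f => // n IHn f f0 w lew.
have [Ow|nOw] := pselect (Omega w); last by rewrite coef_out.
pose fst (i : 'I_p) (a : 'X_{1..p}) := [pick j : 'I_p | a j != 0%N] == Some i.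
pose g i : tseries Delta A := trunc Delta (fun b =>
  let a := (b + U_(i))%MM in if fst i a then f a else 0).
have fE : f = \sum_(i < p) tvar Delta A i * g i.
  apply: tseriesP => a Da; rewrite coef_sum.
  have coefv i : (tvar Delta A i * g i) a = if fst i a then f a else 0.
    rewrite coefM //.
    have [ai|ai] := eqVneq (a i) 0%N.
      rewrite /msum big1 => [|h /eqP aE].
        rewrite /fst; case: pickP => [j aj|//]; case: eqP => // -[ji].
        by rewrite ji ai eqxx in aj.
      rewrite trunc_in; last exact: coideal_addl aE Da.
      case: eqP => [hE|]; last by rewrite mul0r.
      by have := congr1 (fun m : 'X_{1..p} => m i) aE; rewrite ai hE mnmDE mnm1E eqxx.
    have aE : a = (U_(i) + (a - U_(i)))%MM.
      by rewrite addmC submK // lep1mP.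
    have F0 b c : a = (b + c)%MM -> tvar Delta A i b * g i c =
        if c == (a - U_(i))%MM then tvar Delta A i b * g i c else 0.
      move=> abc; case: eqP => // /eqP cN; rewrite trunc_in; last exact: coideal_addl abc Da.
      case: eqP => [bE|]; last by rewrite mul0r.
      by rewrite abc bE addmC addmK eqxx in cN.
    rewrite (eq_msum F0) (msumE _ (ltnSn _)).
    have l1 : (mdeg (U_(i)%MM : 'X_{1..p}) < (mdeg a).+1)%N.
      by rewrite ltnS aE mdegD leq_addr.
    have l2 : (mdeg (a - U_(i))%MM < (mdeg a).+1)%N by rewrite ltnS mdegB.
    rewrite (bigD1 (BMultinom l1)) //= [X in _ + X]big1 ?addr0; last first.
      move=> b; rewrite -(inj_eq val_inj) /= => bN; rewrite big1 // => c _.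
      case: ifP => // /eqP abc; case: eqP => // cE; case/eqP: bN.
      by apply: (@addIm _ (c : 'X_{1..p})); rewrite -abc cE.
    rewrite (bigD1 (BMultinom l2)) //= [X in _ + X]big1 ?addr0; last first.
      by move=> c; rewrite -(inj_eq val_inj) /= => /negPf->; rewrite if_same.
    rewrite -aE !eqxx.
    have -> : tvar Delta A i U_(i)%MM = 1.
      by rewrite trunc_in ?eqxx //; exact: coideal_addl aE Da.
    rewrite mul1r /g trunc_in; last exact: coideal_addr aE Da.
    by rewrite /= addmC -aE.
  under eq_bigr => i _ do rewrite coefv.
  case pickE: [pick j : 'I_p | a j != 0%N] => [i|].
    rewrite (bigD1 i) //= /fst pickE eqxx big1 ?addr0 // => j.
    rewrite -[j == i](inj_eq (@Some_inj _)) eq_sym => /negPf ->; by [].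
  rewrite big1 => [|i _]; last by rewrite /fst pickE.
  apply: f0; suff -> : a = 0%MM by rewrite mdeg0.
  apply/mnmP=> j; rewrite mnm0E; move: pickE; case: pickP => // + _.
  by move/(_ j)/negbFE/eqP.
rewrite fE rmorph_sum coef_sum big1 // => i _.
rewrite rmorphM coefM // /msum big1 // => h /eqP wE.
have [->|h0] := eqVneq (h.1 : 'X_{1..q}) 0%MM.
  by rewrite substmap_var mul0r.
rewrite [X in _ * X]IHn ?mulr0 // => [b lb|].
  rewrite /g truncE /=; case: ifP => // _; case: ifP => // _; apply: f0.
  by rewrite mdegD mdeg1 addn1.
exact: mdeg_lt_addl wE h0 lew.
Qed.

Lemma substmap_mon_small a w :
  (mdeg w < mdeg a)%N -> phi (tmon Delta A a) w = 0.
Proof.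
apply: substmap_order => b lb; rewrite truncE; case: ifP => // _.
by case: eqP => // ba; rewrite ba ltnn in lb.
Qed.

Lemma substmapE (f : tseries Delta A) w :
  phi f w = \sum_(a : 'X_{1..p < (mdeg w).+1}) phi (tmon Delta A a) w * f a.
Proof.
pose g : tseries Delta A :=
  \sum_(a : 'X_{1..p < (mdeg w).+1}) tconst Delta (f a) * tmon Delta A a.
have -> : phi f w = phi g w.
  apply/eqP; rewrite -subr_eq0 -coefB -rmorphB; apply/eqP.
  apply: (@substmap_order (mdeg w).+1) => // a la; rewrite coefB coef_sum.
  have [Da|nDa] := pselect (Delta a); last by rewrite coef_out // big1 ?subr0 // => b _; rewrite coef_out.
  rewrite (bigD1 (BMultinom la)) //= big1 ?addr0 => [|b].
    by rewrite coefcM trunc_in // eqxx mulr1 subrr.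
  rewrite -(inj_eq val_inj) /= eq_sym => /negPf ba.
  by rewrite coefcM trunc_in // ba mulr0.
rewrite rmorph_sum coef_sum; apply: eq_bigr => a _.
by rewrite rmorphM substmap_alg coefcM mulrC.
Qed.

Lemma subst_act_at0 (R : pzRingType) (iota : {rmorphism A -> R})
  (r : tseries Delta R) : subst_act iota phi r 0%MM = r 0%MM.
Proof.
rewrite trunc_in; last exact: coideal0.
have l0 : (mdeg (0%MM : 'X_{1..p}) < (mdeg (0%MM : 'X_{1..q})).+1)%N.
  by rewrite !mdeg0.
rewrite (bigD1 (BMultinom l0)) //= big1 ?addr0 => [|b].
  have -> : tmon Delta A 0%MM = 1 by [].
  by rewrite rmorph1 coef1 eqxx rmorph1 mul1r.
rewrite -(inj_eq val_inj) /= => b0.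
have lt (m : 'X_{1..p}) : m != 0%MM -> (mdeg (0%MM : 'X_{1..q}) < mdeg m)%N.
  by rewrite mdeg0 lt0n mdeg_eq0.
by rewrite substmap_mon_small ?rmorph0 ?mul0r //; apply: lt.
Qed.

End SubstTheory.

(* End_k(A), the k-algebra structure of A being given by eta.                 *)
Record kend (k A : comPzRingType) (eta : {rmorphism k -> A}) := KEnd {
  kend_fun :> A -> A;
  kend_linear : forall c x y, kend_fun (eta c * x + y) = eta c * kend_fun x + kend_fun y
}.

HB.instance Definition _ (k A : comPzRingType) (eta : {rmorphism k -> A}) :=
  gen_eqMixin (kend eta).
HB.instance Definition _ (k A : comPzRingType) (eta : {rmorphism k -> A}) :=
  gen_choiceMixin (kend eta).

Section KEndRing.
Variables (k A : comPzRingType) (eta : {rmorphism k -> A}).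
Implicit Types f g h : kend eta.

Lemma kendP f g : f =1 g -> f = g.
Proof.
case: f g => [f f1] [g g1] /= /funext E; move: f1 g1; rewrite E => f1 g1.
by rewrite (Prop_irrelevance f1 g1).
Qed.

Fact kend_is_zmod f : zmod_morphism f.
Proof.
move=> x y; rewrite addrC -[- y]mulN1r -(rmorph1 eta) -rmorphN kend_linear.
by rewrite rmorphN rmorph1 mulN1r addrC.
Qed.
HB.instance Definition _ f := GRing.isZmodMorphism.Build A A f (kend_is_zmod f).

Lemma kendZ f c x : f (eta c * x) = eta c * f x.
Proof. by rewrite -[_ * x]addr0 kend_linear raddf0 addr0. Qed.

Program Definition kzero := @KEnd _ _ eta (fun=> 0) _.
Next Obligation. by rewrite mulr0 addr0. Qed.
Program Definition kone := @KEnd _ _ eta id _.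
Program Definition kopp f := @KEnd _ _ eta (fun x => - f x) _.
Next Obligation. by rewrite kend_linear opprD mulrN. Qed.
Program Definition kadd f g := @KEnd _ _ eta (fun x => f x + g x) _.
Next Obligation. by rewrite !kend_linear mulrDr addrACA. Qed.
Program Definition kcomp f g := @KEnd _ _ eta (fun x => f (g x)) _.
Next Obligation. by rewrite !kend_linear. Qed.

Fact kaddA : associative kadd.
Proof. by move=> f g h; apply: kendP => x /=; rewrite addrA. Qed.
Fact kaddC : commutative kadd.
Proof. by move=> f g; apply: kendP => x /=; rewrite addrC. Qed.
Fact kadd0 : left_id kzero kadd.
Proof. by move=> f; apply: kendP => x /=; rewrite add0r. Qed.
Fact kaddN : left_inverse kzero kopp kadd.
Proof. by move=> f; apply: kendP => x /=; rewrite addNr. Qed.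
HB.instance Definition _ :=
  GRing.isZmodule.Build (kend eta) kaddA kaddC kadd0 kaddN.

Fact kcompA : associative kcomp.
Proof. by move=> f g h; apply: kendP. Qed.
Fact kcomp1f : left_id kone kcomp.
Proof. by move=> f; apply: kendP. Qed.
Fact kcompf1 : right_id kone kcomp.
Proof. by move=> f; apply: kendP. Qed.
Fact kcompDl : left_distributive kcomp +%R.
Proof. by move=> f g h; apply: kendP. Qed.
Fact kcompDr : right_distributive kcomp +%R.
Proof. by move=> f g h; apply: kendP => x; rewrite /= raddfD. Qed.
HB.instance Definition _ := GRing.Zmodule_isPzRing.Build (kend eta)
  kcompA kcomp1f kcompf1 kcompDl kcompDr.

Lemma kend0E x : (0 : kend eta) x = 0. Proof. by []. Qed.
Lemma kend1E x : (1 : kend eta) x = x. Proof. by []. Qed.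
Lemma kendDE f g x : (f + g) x = f x + g x. Proof. by []. Qed.
Lemma kendNE f x : (- f) x = - f x. Proof. by []. Qed.
Lemma kendBE f g x : (f - g) x = f x - g x. Proof. by []. Qed.
Lemma kendME f g x : (f * g) x = f (g x). Proof. by []. Qed.
Lemma kend_sumE I (e : seq I) (P : pred I) (F : I -> kend eta) x :
  (\sum_(i <- e | P i) F i) x = \sum_(i <- e | P i) F i x.
Proof. exact: (big_morph (fun f => kend_fun f x)). Qed.
Lemma kendMnE f n x : (f *+ n) x = f x *+ n.
Proof. by elim: n => [|n IHn]; rewrite ?mulr0n // !mulrS kendDE IHn. Qed.

Program Definition kmult (a : A) := @KEnd _ _ eta (fun x => a * x) _.
Next Obligation. by rewrite mulrDr mulrCA. Qed.

Fact kmult_is_zmod : zmod_morphism kmult.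
Proof. by move=> a b; apply: kendP => x; rewrite kendBE /= mulrBl. Qed.
Fact kmult_is_monoid : monoid_morphism kmult.
Proof.
split=> [|a b]; apply: kendP => x; first by rewrite /= mul1r.
by rewrite kendME /= mulrA.
Qed.
HB.instance Definition _ :=
  GRing.isZmodMorphism.Build A (kend eta) kmult kmult_is_zmod.
HB.instance Definition _ :=
  GRing.isMonoidMorphism.Build A (kend eta) kmult kmult_is_monoid.

End KEndRing.
Arguments kmult {k A} eta a.

Record derivation (k A : comPzRingType) (eta : {rmorphism k -> A}) :=
  Derivation {
    der_end :> kend eta;
    der_leibniz : forall x y, der_end (x * y) = der_end x * y + x * der_end y
  }.

HB.instance Definition _ (k A : comPzRingType) (eta : {rmorphism k -> A}) :=
  gen_eqMixin (derivation eta).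
HB.instance Definition _ (k A : comPzRingType) (eta : {rmorphism k -> A}) :=
  gen_choiceMixin (derivation eta).

Section DerivationTheory.
Variables (k A : comPzRingType) (eta : {rmorphism k -> A}).
Implicit Types d : derivation eta.

Lemma derP d d' : der_end d = der_end d' -> d = d'.
Proof.
case: d d' => [f f1] [g g1] /= E; move: f1 g1; rewrite E => f1 g1.
by rewrite (Prop_irrelevance f1 g1).
Qed.

Program Definition dzero := @Derivation _ _ eta 0 _.
Next Obligation. by rewrite mul0r mulr0 addr0. Qed.
Program Definition dopp d := @Derivation _ _ eta (- der_end d) _.
Next Obligation. by rewrite der_leibniz opprD mulNr mulrN. Qed.
Program Definition dadd d d' := @Derivation _ _ eta (der_end d + der_end d') _.
Next Obligation. by rewrite !der_leibniz mulrDl mulrDr addrACA. Qed.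
Program Definition dscale (a : A) d :=
  @Derivation _ _ eta (kmult eta a * der_end d) _.
Next Obligation. by rewrite der_leibniz mulrDr mulrA (mulrCA a). Qed.

Definition lie_bracket d d' : derivation eta.
Proof.
exists (der_end d * der_end d' - der_end d' * der_end d) => x y.
rewrite !kendBE !kendME !der_leibniz !raddfD /= !der_leibniz mulrBl mulrBr.
set u := d (d' x) * y; set v := d' x * d y; set w := d x * d' y.
set z := x * d (d' y); set u' := d' (d x) * y; set z' := x * d' (d y).
have -> : u + v + (w + z) = (u + z) + (v + w) by rewrite [w + z]addrC addrACA.
rewrite -opprD; have -> : u' + w + (v + z') = (v + w) + (u' + z').
  by rewrite [u' + w]addrC addrACA [w + v]addrC.
by rewrite addrKA opprD addrACA.
Defined.

Fact daddA : associative dadd.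
Proof. by move=> d d' d''; apply: derP; apply: addrA. Qed.
Fact daddC : commutative dadd.
Proof. by move=> d d'; apply: derP; apply: addrC. Qed.
Fact dadd0 : left_id dzero dadd.
Proof. by move=> d; apply: derP; apply: add0r. Qed.
Fact daddN : left_inverse dzero dopp dadd.
Proof. by move=> d; apply: derP; apply: addNr. Qed.
HB.instance Definition _ :=
  GRing.isZmodule.Build (derivation eta) daddA daddC dadd0 daddN.

Fact dscaleA a b d : dscale a (dscale b d) = dscale (a * b) d.
Proof. by apply: derP; rewrite /= rmorphM mulrA. Qed.
Fact dscale1 : left_id 1 dscale.
Proof. by move=> d; apply: derP; rewrite /= rmorph1 mul1r. Qed.
Fact dscaleDr : right_distributive dscale +%R.
Proof. by move=> a d d'; apply: derP; rewrite /= mulrDr. Qed.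
Fact dscaleDl d : {morph dscale^~ d : a b / a + b}.
Proof. by move=> a b; apply: derP; rewrite /= rmorphD mulrDl. Qed.
HB.instance Definition _ := GRing.Zmodule_isLmodule.Build A (derivation eta)
  dscaleA dscale1 dscaleDr dscaleDl.

End DerivationTheory.

Section HasseSchmidt.
Variables (k A : comPzRingType) (eta : {rmorphism k -> A}).

(* D_0 = Id is part of being in U^p(End_k(A); Delta).                         *)
Record HS p (Delta : coideal p) := MkHS {
  HS_val :> useries Delta (kend eta);
  HS_leibniz : forall a, Delta a -> forall x y : A,
    HS_val a (x * y) = msum a (fun b c => HS_val b x * HS_val c y)
}.

HB.instance Definition _ p (Delta : coideal p) := gen_eqMixin (HS Delta).
HB.instance Definition _ p (Delta : coideal p) := gen_choiceMixin (HS Delta).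

Section OneSet.
Variables (p : nat) (Delta : coideal p).
Implicit Types (D E : HS Delta) (f g : tseries Delta A).

Lemma HSP D E : HS_val D = HS_val E -> D = E.
Proof.
case: D E => [r r1] [s s1] /= H; move: r1 s1; rewrite H => r1 s1.
by rewrite (Prop_irrelevance r1 s1).
Qed.

Definition tact (E : tseries Delta (kend eta)) f : tseries Delta A :=
  trunc Delta (fun a => msum a (fun b c => E b (f c))).

Lemma coef_act E f a : Delta a -> tact E f a = msum a (fun b c => E b (f c)).
Proof. exact: trunc_in. Qed.

Lemma tactD (E : tseries Delta (kend eta)) f g : tact E (f + g) = tact E f + tact E g.
Proof.
apply: tseriesP => a Da; rewrite coefD !trunc_in // -msum_split.
by apply: eq_msum => b c _; rewrite coefD raddfD.
Qed.

Lemma tactM (E F : tseries Delta (kend eta)) f : tact (E * F) f = tact E (tact F f).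
Proof.
apply: tseriesP => a Da; rewrite !trunc_in //.
transitivity (msum a (fun b e => msum e (fun c d => E b (F c (f d))))).
  rewrite -(msumA a (fun b c d => E b (F c (f d)))).
  apply: eq_msum => b c aE; rewrite coefM; last exact: coideal_addl aE Da.
  by rewrite /msum kend_sumE.
apply: eq_msum => b c aE; rewrite trunc_in; last exact: coideal_addr aE Da.
by rewrite msum_morph.
Qed.

Lemma tact1 f : tact 1 f = f.
Proof.
apply: tseriesP => a Da; rewrite trunc_in // msum0l ?coef1 ?eqxx //.
by move=> b c /negPf b0; rewrite coef1 b0.
Qed.

Lemma tact_const (E : tseries Delta (kend eta)) x a : tact E (tconst Delta x) a = E a x.
Proof.
have [Da|nDa] := pselect (Delta a); last by rewrite !coef_out.
rewrite trunc_in // msum0r ?coef_const ?eqxx //.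
by move=> b c /negPf c0; rewrite coef_const c0 raddf0.
Qed.

Lemma tact_chi (E : tseries Delta (kend eta)) f :
  tact (chi E) f = chi (tact E f) - tact E (chi f).
Proof.
apply/eqP; rewrite eq_sym subr_eq; apply/eqP.
apply: tseriesP => a Da; rewrite coefD coef_chi !trunc_in // -msum_split.
rewrite msumMn; apply: eq_msum => b c ->.
by rewrite !coef_chi kendMnE raddfMn mdegD mulrnDr.
Qed.

Lemma HS_act D f g : tact (HS_val D) (f * g) = tact (HS_val D) f * tact (HS_val D) g.
Proof.
apply: tseriesP => a Da; rewrite coefM // trunc_in //.
transitivity (msum a (fun b e => msum b (fun b1 b2 => msum e (fun c d =>
    D b1 (f c) * D b2 (g d))))).
  apply: eq_msum => b e aE; rewrite coefM; last exact: coideal_addr aE Da.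
  rewrite msum_morph /msum exchange_big /=; apply: eq_bigr => h _.
  by rewrite HS_leibniz //; exact: coideal_addl aE Da.
rewrite (msumACA a (fun b1 b2 c d => D b1 (f c) * D b2 (g d))).
apply: eq_msum => u v aE; rewrite !trunc_in; first last.
- exact: coideal_addl aE Da.
- exact: coideal_addr aE Da.
rewrite /msum mulr_suml; apply: eq_bigr => h _.
by rewrite mulr_sumr.
Qed.

Lemma act_HS (E : tseries Delta (kend eta)) :
  (forall x y, tact E (tconst Delta x * tconst Delta y)
     = tact E (tconst Delta x) * tact E (tconst Delta y)) ->
  forall a, Delta a -> forall x y : A,
    E a (x * y) = msum a (fun b c => E b x * E c y).
Proof.
move=> EM a Da x y; rewrite -tact_const rmorphM EM coefM //.
by apply: eq_msum => b c _; rewrite !tact_const.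
Qed.

Fact HS_one_subproof a : Delta a -> forall x y : A,
  useries_val (1 : useries Delta (kend eta))%g a (x * y) =
  msum a (fun b c => useries_val (1 : useries Delta (kend eta))%g b x *
                     useries_val (1 : useries Delta (kend eta))%g c y).
Proof. by apply: act_HS => x y; rewrite useries_oneE !tact1. Qed.
Definition HS_one := MkHS HS_one_subproof.

Fact HS_mul_subproof D E a : Delta a -> forall x y : A,
  useries_val (HS_val D * HS_val E)%g a (x * y) =
  msum a (fun b c => useries_val (HS_val D * HS_val E)%g b x *
                     useries_val (HS_val D * HS_val E)%g c y).
Proof. by apply: act_HS => x y; rewrite useries_mulE !tactM !HS_act. Qed.
Definition HS_mul D E := MkHS (HS_mul_subproof D E).

Lemma HS_actV D f g : tact (HS_val D)^-1%g (f * g) =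
  tact (HS_val D)^-1%g f * tact (HS_val D)^-1%g g.
Proof.
have VK h : tact (HS_val D)^-1%g (tact (HS_val D) h) = h.
  by rewrite -tactM -useries_mulE mulVg tact1.
have KV h : tact (HS_val D) (tact (HS_val D)^-1%g h) = h.
  by rewrite -tactM -useries_mulE mulgV tact1.
by rewrite -{1}(KV f) -{1}(KV g) -HS_act VK.
Qed.

Fact HS_inv_subproof D a : Delta a -> forall x y : A,
  useries_val (HS_val D)^-1%g a (x * y) =
  msum a (fun b c => useries_val (HS_val D)^-1%g b x *
                     useries_val (HS_val D)^-1%g c y).
Proof. by apply: act_HS => x y; rewrite HS_actV. Qed.
Definition HS_inv D := MkHS (HS_inv_subproof D).

Fact HS_mulA : associative HS_mul.
Proof. by move=> D E F; apply: HSP; apply: mulgA. Qed.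
Fact HS_mul1 : left_id HS_one HS_mul.
Proof. by move=> D; apply: HSP; apply: mul1g. Qed.
Fact HS_mulD1 : right_id HS_one HS_mul.
Proof. by move=> D; apply: HSP; apply: mulg1. Qed.
Fact HS_mulV : left_inverse HS_one HS_inv HS_mul.
Proof. by move=> D; apply: HSP; apply: mulVg. Qed.
Fact HS_mulDV : right_inverse HS_one HS_inv HS_mul.
Proof. by move=> D; apply: HSP; apply: mulgV. Qed.
HB.instance Definition _ := isGroup.Build (HS Delta)
  HS_mulA HS_mul1 HS_mulD1 HS_mulV HS_mulDV.

Lemma HS_mulE D E : HS_val (D * E)%g = (HS_val D * HS_val E)%g.
Proof. by []. Qed.

Definition HS_eval D (x : A) : tseries Delta A :=
  tmap (fun d : kend eta => d x) D.

Lemma HS_evalE D x : HS_eval D x = tact (HS_val D) (tconst Delta x).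
Proof. by apply: tseriesP => a Da; rewrite trunc_in // tact_const. Qed.

Fact eps_leibniz D a x y :
  eps D a (x * y) = eps D a x * y + x * eps D a y.
Proof.
have epsE f : tact (eps D) f = tact (HS_val D)^-1%g (chi (tact (HS_val D) f)) - chi f.
  rewrite tactM tact_chi; set G := tact (HS_val D)^-1%g.
  have -> h h' : G (h - h') = G h - G h'.
    by apply/eqP; rewrite eq_sym subr_eq -tactD subrK.
  by rewrite /G -!tactM -useries_mulE mulVg tact1.
have epsM f g : tact (eps D) (f * g) = tact (eps D) f * g + f * tact (eps D) g.
  have VK h : tact (HS_val D)^-1%g (tact (HS_val D) h) = h.
    by rewrite -tactM -useries_mulE mulVg tact1.
  rewrite !epsE HS_act !chiM tactD !HS_actV !VK mulrBl mulrBr opprD.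
  by rewrite addrACA.
rewrite -tact_const rmorphM epsM coefD coefMc coefcM.
by rewrite !tact_const.
Qed.

(* epsilon(D), computed in End_k(A)[[s]]_Delta, retyped with coefficients in  *)
(* Der_k(A).                                                                  *)
Definition HS_eps D : tseries Delta (derivation eta).
Proof.
exists (fun a => @Derivation _ _ eta (eps D a) (eps_leibniz D a)).
by move=> a nDa; apply: derP; rewrite /= coef_out.
Defined.

Lemma HS_eps_at0 D : HS_eps D 0%MM = 0.
Proof. by apply: derP; rewrite /= eps_at0. Qed.

Lemma HS_epsE D a : der_end (HS_eps D a) = eps D a.
Proof. by []. Qed.

End OneSet.

Section Subst.
Variables (p q : nat) (Delta : coideal p) (Omega : coideal q).
Variables (phi : substmap Delta Omega A) (D : HS Delta).

Fact HS_subst_at0 : subst_act (kmult eta) phi D 0%MM = 1.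
Proof. by rewrite subst_act_at0 useries_at0. Qed.
Definition HS_subst_val := USeries HS_subst_at0.

Fact HS_subst_leibniz a : Omega a -> forall x y : A,
  HS_subst_val a (x * y) =
  msum a (fun b c => HS_subst_val b x * HS_subst_val c y).
Proof.
have E x : tact HS_subst_val (tconst Omega x) = phi (HS_eval D x).
  apply: tseriesP => w Ow; rewrite tact_const substmapE trunc_in // kend_sumE.
  apply: eq_bigr => b _; rewrite kendME /=; congr (_ * _).
  by rewrite truncE; case: asboolP => // nDb; rewrite coef_out.
apply: act_HS => x y.
by rewrite -rmorphM !E HS_evalE rmorphM HS_act -!HS_evalE rmorphM.
Qed.
Definition HS_subst : HS Omega := MkHS HS_subst_leibniz.

End Subst.

End HasseSchmidt.

Section Structures.
Variables (k A : comPzRingType) (eta : {rmorphism k -> A}).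
Variables (R : pzRingType) (iota : {rmorphism A -> R}).

Definition HS_system :=
  forall (p : nat) (Delta : coideal p), HS eta Delta -> useries Delta R.

Record is_HS_structure (Psi : HS_system) : Prop := {
  HSs_morph : forall p (Delta : coideal p) (D E : HS eta Delta),
    Psi p Delta (D * E)%g = (Psi p Delta D * Psi p Delta E)%g;
  HSs_comm : forall p (Delta : coideal p) (D : HS eta Delta) (a : A),
    useries_val (Psi p Delta D) * tconst Delta (iota a)
    = tmap iota (HS_eval D a) * useries_val (Psi p Delta D);
  HSs_subst : forall p q (Delta : coideal p) (Omega : coideal q)
      (phi : substmap Delta Omega A) (D : HS eta Delta),
    useries_val (Psi q Omega (HS_subst phi D))
    = subst_act iota phi (Psi p Delta D)
}.

(* Additivity, 1 \in F 0 and k-stability need not be listed: they follow from *)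
(* filtB, filtM and filt_iota.                                                *)
Record is_filtration (F : nat -> set R) : Prop := {
  filt0 : forall d, F d 0;
  filtB : forall d x y, F d x -> F d y -> F d (x - y);
  filtM : forall d e x y, F d x -> F e y -> F (d + e)%N (x * y);
  filt_incr : forall d x, F d x -> F d.+1 x;
  filt_exh : forall x, exists d, F d x;
  filt_iota : forall a, F 0%N (iota a)
}.

Definition filtered_HS (F : nat -> set R) (Psi : HS_system) : Prop :=
  forall p (Delta : coideal p) (D : HS eta Delta) a,
    Delta a -> F (mdeg a) (Psi p Delta D a).

Record LR_admissible (nabla : derivation eta -> R) : Prop := {
  LR_linear : forall (a : A) (d d' : derivation eta),
    nabla (a *: d + d') = iota a * nabla d + nabla d';
  LR_comm : forall (d : derivation eta) (a : A),
    nabla d * iota a = iota a * nabla d + iota (d a);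
  LR_bracket : forall d d' : derivation eta,
    nabla (lie_bracket d d') = nabla d * nabla d' - nabla d' * nabla d
}.

End Structures.

(* Main.v *)
Require Import Defs.
From HB Require Import structures.
From mathcomp Require Import all_boot all_order all_algebra.
From mathcomp Require Import boolp classical_sets.
From mathcomp Require Import mpoly.
(* Defs again: poly and mpoly shadow its lemmas coefD, coefM, coefB and so on. *)
Import Defs GRing.Theory.
Local Open Scope ring_scope.

Set Implicit Arguments.
Unset Strict Implicit.
Unset Printing Implicit Defensive.

(******************************************************************************)
(* Put N for the coefficientwise extension of nabla.  The required condition  *)
(* is the differential equation chi(r) = r N(eps(D)) with r_0 = 1; as Q       *)
(* embeds in R, it has exactly one solution r =: Psi(D), found degree by      *)
(* degree, so that two series agree once they solve the same equation.        *)
(*                                                                            *)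
(* Intertwining: r x = D(x) r for x in A[[s]] (this is axiom (ii)) and        *)
(* r N(d) = N(D d D^-1) r for d in Der[[s]]; with                             *)
(* eps(D E) = E^-1 eps(D) E + eps(E), the latter makes Psi multiplicative.    *)
(*                                                                            *)
(* Substitution: D lifts to N^p (extend eps(D) by 0 and integrate), so one    *)
(* may assume that Delta = N^p, where the partial derivatives d_i act.  The   *)
(* equation for r implies d_i r = r N(D^-1 d_i D), and the chain rule         *)
(* chi(phi.r) = sum_i chi(phi(s_i)) (phi.(d_i r)) together with intertwining  *)
(* yields chi(phi.r) = (phi.r) N(g), where g in Der[[t]] depends on phi and D *)
(* only.  The case R = End_k(A), r = D of the same formula identifies g as    *)
(* eps(phi.D).                                                                *)
(******************************************************************************)

(** * Coefficientwise maps and the equation chi r = r y *)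

(** Over $\mathbb{Q}$ the Euler operator [chi] is invertible in positive degrees, so a series $r$
    with $r_0 = 1$ is recovered from its logarithmic derivative $\varepsilon(r)$ ([ode_solP],
    [ode_uniq]). Thus $D$ is the flow of $\varepsilon(D)$ in $\mathrm{End}_k(A)$ and $\Psi(D)$ is
    the flow of its image under nabla in $R$. As nabla respects brackets and the action on $A$,
    identities between flows that come from such commutators carry over to $R$.

    The tool for this is [intertwine]: a commutation rule for the right-hand side of the equation
    integrates to one for the solution. It yields [sol_comm] (the commutation axiom) and [sol_mul]
    (multiplicativity). Compatibility with substitutions is [sol_subst], which rests on [sol_pd] and
    the chain rule [chi_subst_act]; [HS_lift] reduces it to $\Delta = \mathbb{N}^p$. The inclusion
    of $\mathrm{Der}_k(A)$ in $\mathrm{End}_k(A)$ is itself LR-admissible ([LR_kmult]), so the same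
    lemmas also describe $D$. The filtration statement follows from the recursion for the
    coefficients. *)

Section Tmap.
Variables (p : nat) (Delta : coideal p).

Lemma coef_tmap (M N : zmodType) (f : {additive M -> N}) (r : tseries Delta M) a :
  tmap f r a = f (r a).
Proof.
have [Da|nDa] := pselect (Delta a); first exact: trunc_in.
by rewrite !coef_out // raddf0.
Qed.

Lemma tmap_is_zmod (M N : zmodType) (f : {additive M -> N}) :
  zmod_morphism (@tmap p Delta M N f).
Proof.
by move=> r s; apply: tseriesP => a _; rewrite coefB !coef_tmap coefB raddfB.
Qed.
HB.instance Definition _ (M N : zmodType) (f : {additive M -> N}) :=
  GRing.isZmodMorphism.Build (tseries Delta M) (tseries Delta N) (tmap f)
    (tmap_is_zmod f).

Lemma tmap_is_monoid (R S : pzRingType) (f : {rmorphism R -> S}) :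
  monoid_morphism (@tmap p Delta R S f).
Proof.
split=> [|r s]; apply: tseriesP => a Da; rewrite coef_tmap.
  by rewrite !coef1 /= rmorph_nat.
rewrite !coefM // msum_morph; apply: eq_msum => b c _.
by rewrite !coef_tmap /= rmorphM.
Qed.
HB.instance Definition _ (R S : pzRingType) (f : {rmorphism R -> S}) :=
  GRing.isMonoidMorphism.Build (tseries Delta R) (tseries Delta S) (tmap f)
    (tmap_is_monoid f).

Lemma tmap_const (M N : zmodType) (f : {additive M -> N}) (m : M) :
  tmap f (tconst Delta m) = tconst Delta (f m).
Proof. by apply: tseriesP => a _; rewrite coef_tmap !coef_const raddfMn. Qed.

Lemma tmap_chi (M N : zmodType) (f : {additive M -> N}) (r : tseries Delta M) :
  tmap f (chi r) = chi (tmap f r).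
Proof. by apply: tseriesP => a _; rewrite coef_tmap !coef_chi coef_tmap raddfMn. Qed.

Lemma tmap_inj (M N : zmodType) (f : {additive M -> N}) :
  injective f -> injective (@tmap p Delta M N f).
Proof.
by move=> fI r s rs; apply: tseriesP => a _; apply: fI; rewrite -!coef_tmap rs.
Qed.

Lemma chi_is_zmod (M : zmodType) : zmod_morphism (@chi p Delta M).
Proof.
by move=> r s; apply: tseriesP => a _; rewrite coefB !coef_chi coefB mulrnBl.
Qed.
HB.instance Definition _ (M : zmodType) :=
  GRing.isZmodMorphism.Build (tseries Delta M) (tseries Delta M) (@chi p Delta M)
    (@chi_is_zmod M).

Lemma chi_const (M : zmodType) (m : M) : chi (tconst Delta m) = 0.
Proof.
apply: tseriesP => a _; rewrite coef_chi coef_const coef0.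
by case: eqP => [->|_]; rewrite ?mdeg0 ?mulr0n // mul0rn.
Qed.

End Tmap.

(** If $c \neq 0$ then $|b| < |a|$. This is how the inductions on the degree exploit a right factor
    without constant term. *)
Lemma eq_msum_lt p (M : nmodType) a (F G : 'X_{1..p} -> 'X_{1..p} -> M) :
  (forall b, F b 0%MM = G b 0%MM) ->
  (forall b c, a = (b + c)%MM -> (mdeg b < mdeg a)%N -> F b c = G b c) ->
  msum a F = msum a G.
Proof.
move=> FG0 FG; apply: eq_msum => b c aE.
have [->|c0] := eqVneq c 0%MM; first exact: FG0.
by apply: FG => //; rewrite aE mdegD -addn1 leq_add2l lt0n mdeg_eq0.
Qed.

Section Ode.
Variables (R : pzRingType) (ratR : {rmorphism rat -> R}).

Lemma rat_mulIn n (x y : R) : (0 < n)%N -> x *+ n = y *+ n -> x = y.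
Proof.
move=> n0 xy; have q1 : ratR n%:R^-1 * n%:R = 1.
  rewrite -(rmorph_nat ratR) -rmorphM mulVf ?rmorph1 //.
  by rewrite Num.Theory.pnatr_eq0 -lt0n.
rewrite -[x]mul1r -[y]mul1r -q1 -!mulrA.
by rewrite (mulr_natl x) (mulr_natl y) xy.
Qed.

Lemma rat_divnK n (x : R) : (0 < n)%N -> (ratR n%:R^-1 * x) *+ n = x.
Proof.
move=> n0; rewrite -mulrnAl -mulr_natr -(rmorph_nat ratR) -rmorphM.
by rewrite mulVf ?rmorph1 ?mul1r // Num.Theory.pnatr_eq0 -lt0n.
Qed.

Variables (p : nat) (Delta : coideal p).
Implicit Types u v w y : tseries Delta R.

(** The left side has coefficient $(|a| + k) w_a$, the right side involves only $w_b$ with $|b| <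
    |a|$. The factor can be cancelled unless $a = 0$ and $k = 0$, the case of the initial condition.
    Here $k = 0$ compares two solutions and $k = 1$ serves partial derivatives. *)
Lemma ode_eq0 k w y : y 0%MM = 0 -> (k = 0%N -> w 0%MM = 0) ->
  chi w + w *+ k = w * y -> w = 0.
Proof.
move=> y0 w0 wE; suff H n a : (mdeg a < n)%N -> w a = 0.
  by apply: tseriesP => a _; rewrite coef0 (H (mdeg a).+1).
elim: n a => // n IHn a; rewrite ltnS => an.
have [Da|nDa] := pselect (Delta a); last by rewrite coef_out.
have coefMn (r : tseries Delta R) j : (r *+ j) a = r a *+ j.
  by elim: j => [|j IHj]; rewrite ?coef0 // !mulrS coefD IHj.
have wa : w a *+ (mdeg a + k) = 0.
  rewrite mulrnDr -coef_chi -coefMn -coefD wE coefM //.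
  rewrite (eq_msum_lt (G := fun _ _ => 0)) => [|b|b c _ ba].
  - by rewrite /msum big1.
  - by rewrite y0 mulr0.
  - by rewrite IHn ?mul0r //; apply: leq_trans ba an.
have [ak|ak] := posnP (mdeg a + k).
  move/eqP: ak; rewrite addn_eq0 mdeg_eq0 => /andP[/eqP-> /eqP k0].
  exact: w0.
by apply: (rat_mulIn ak); rewrite mul0rn.
Qed.

Lemma ode_uniq u v y : y 0%MM = 0 -> u 0%MM = v 0%MM ->
  chi u = u * y -> chi v = v * y -> u = v.
Proof.
move=> y0 uv0 uE vE; apply/eqP; rewrite -subr_eq0; apply/eqP.
apply: (@ode_eq0 0 _ y) => //; first by rewrite coefB uv0 subrr.
by rewrite raddfB /= uE vE addr0 mulrBl.
Qed.

(** One Picard iteration for $\chi(u) = u y$, $u_0 = 1$. *)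
Definition ode_step y u : tseries Delta R :=
  trunc Delta (fun a => if a == 0%MM then 1 else ratR (mdeg a)%:R^-1 * (u * y) a).

Lemma coef_ode_step y u a : Delta a -> a != 0%MM ->
  ode_step y u a = ratR (mdeg a)%:R^-1 * (u * y) a.
Proof. by move=> Da /negPf a0; rewrite trunc_in // a0. Qed.

Definition ode_iter y n : tseries Delta R := iter n (ode_step y) 1.

Lemma mul_coef_lt y u v a : y 0%MM = 0 ->
  (forall b, (mdeg b < mdeg a)%N -> u b = v b) -> (u * y) a = (v * y) a.
Proof.
move=> y0 uv; have [Da|nDa] := pselect (Delta a); last by rewrite !coef_out.
rewrite !coefM //; apply: eq_msum_lt => [b|b c _ /uv->//].
by rewrite y0 !mulr0.
Qed.

(** As $y_0 = 0$, each iteration settles one further degree; hence the diagonal choice in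
    [ode_sol]. *)
Lemma ode_iter_stable y n m a : y 0%MM = 0 -> (mdeg a <= n)%N -> (n <= m)%N ->
  ode_iter y m a = ode_iter y n a.
Proof.
have at0 j : ode_iter y j 0%MM = 1.
  have D0 := coideal0 Delta.
  by case: j => [|j]; rewrite ?coef1 ?eqxx //= trunc_in ?eqxx.
move=> y0; elim: n m a => [|n IHn] [|m] a //.
  by rewrite leqn0 mdeg_eq0 => /eqP-> _; rewrite !at0.
move=> an nm; have [->|a0] := eqVneq a 0%MM; first by rewrite !at0.
have [Da|nDa] := pselect (Delta a); last by rewrite !coef_out.
rewrite /= !coef_ode_step //; congr (_ * _); apply: mul_coef_lt => // b ba.
by apply: IHn => //; rewrite -ltnS (leq_trans ba).
Qed.

Definition ode_sol y : tseries Delta R :=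
  trunc Delta (fun a => ode_iter y (mdeg a) a).

Lemma ode_sol_at0 y : ode_sol y 0%MM = 1.
Proof.
by rewrite trunc_in ?mdeg0 /ode_iter /= ?coef1 ?eqxx //; apply: coideal0.
Qed.

Lemma ode_solP y : y 0%MM = 0 -> chi (ode_sol y) = ode_sol y * y.
Proof.
move=> y0; apply: tseriesP => a Da; rewrite coef_chi.
have [->|a0] := eqVneq a 0%MM; first by rewrite mdeg0 coefM_at0 y0 mulr0.
have ma : (0 < mdeg a)%N by rewrite lt0n mdeg_eq0.
have -> : (ode_sol y * y) a = (ode_iter y (mdeg a).-1 * y) a.
  apply: mul_coef_lt => // b ba.
  have [Db|nDb] := pselect (Delta b); last by rewrite !coef_out.
  by rewrite [LHS]trunc_in // (@ode_iter_stable _ (mdeg b)) // -ltnS prednK.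
rewrite [ode_sol y a]trunc_in // -[in LHS](prednK ma) /ode_iter iterS.
by rewrite coef_ode_step // -(prednK ma) rat_divnK.
Qed.

End Ode.

(** * Intertwining *)

Lemma mulr_msuml p (R : pzRingType) a (F : 'X_{1..p} -> 'X_{1..p} -> R) x :
  msum a F * x = msum a (fun b c => F b c * x).
Proof. exact: mulr_suml. Qed.

Lemma mulr_msumr p (R : pzRingType) a (F : 'X_{1..p} -> 'X_{1..p} -> R) x :
  x * msum a F = msum a (fun b c => x * F b c).
Proof. exact: mulr_sumr. Qed.

(** The action of the operator series $\sum_b T_b \mathbf{s}^b$ on $M[[\mathbf{s}]]_\Delta$. *)
Definition tfam p (Delta : coideal p) (M N : nmodType)
    (T : 'X_{1..p} -> M -> N) (x : tseries Delta M) : tseries Delta N :=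
  trunc Delta (fun a => msum a (fun b c => T b (x c))).

Section Intertwine.
Variables (p : nat) (Delta : coideal p).
Variables (R : pzRingType) (ratR : {rmorphism rat -> R}).
Variables (M : zmodType) (h : {additive M -> R}).
Variable T : 'X_{1..p} -> M -> M.
Variable r : tseries Delta R.

(** The variables are central, so the relation for constants $m$ extends to series by reassociating
    the convolution. *)
Lemma intertwine_series :
  (forall a m, Delta a -> r a * h m = msum a (fun b c => h (T b m) * r c)) ->
  forall x, r * tmap h x = tmap h (tfam T x) * r.
Proof.
move=> rT x; apply: tseriesP => a Da; rewrite !coefM //.
transitivity (msum a (fun b c => msum b (fun b1 b2 => h (T b1 (x c)) * r b2))).
  apply: eq_msum => b c aE; rewrite coef_tmap rT //; exact: coideal_addl aE Da.
transitivity (msum a (fun b c => msum b (fun b1 b2 => h (T b1 (x b2)) * r c))).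
  rewrite (msumA a (fun b1 b2 c => h (T b1 (x c)) * r b2)).
  rewrite (msumA a (fun b1 b2 c => h (T b1 (x b2)) * r c)).
  by apply: eq_msum => b c _; rewrite msumC.
apply: eq_msum => b c aE; rewrite coef_tmap trunc_in; last exact: coideal_addl aE Da.
by rewrite msum_morph mulr_msuml.
Qed.

Variables (y : tseries Delta R) (op : 'X_{1..p} -> M -> M).
Hypotheses (y0 : y 0%MM = 0) (rE : chi r = r * y) (r0 : r 0%MM = 1).
Hypotheses (op0 : forall m, op 0%MM m = 0) (T0 : forall m, T 0%MM m = m).
Hypothesis T_0 : forall a, T a 0 = 0.
Hypothesis y_comm : forall a m, y a * h m = h m * y a + h (op a m).
Hypothesis T_ode : forall a m, Delta a ->
  T a m *+ mdeg a = msum a (fun b c => T b (op c m)).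

(** Both sides obey the same recursion: $\chi(r) h(m) = r y h(m) = r h(m) y + r h(\mathrm{op}\, m)$,
    and [T_ode] is the matching rule for $\chi(T m)$. Since $y$ and [op] vanish at 0, only $r_b$
    with $|b| < |a|$ need to be moved across. *)
Lemma intertwine_coef a m : Delta a ->
  r a * h m = msum a (fun b c => h (T b m) * r c).
Proof.
have [n] := ubnP (mdeg a); elim: n a m => // n IHn a m; rewrite ltnS => an Da.
have [->|a0] := eqVneq a 0%MM; first by rewrite msum_at0 r0 T0 mulr1 mul1r.
have ma : (0 < mdeg a)%N by rewrite lt0n mdeg_eq0.
apply: (rat_mulIn ratR ma); rewrite -mulrnAl -coef_chi rE coefM //.
rewrite mulr_msuml msumMn.
(* Move [y c] past [h m] by [y_comm], then [r b] past [h] by induction. *)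
transitivity (msum a (fun b c => msum b (fun b1 b2 => h (T b1 m) * r b2 * y c)
    + msum b (fun b1 b2 => h (T b1 (op c m)) * r b2))).
  apply: eq_msum_lt => [b|b c aE ba].
    rewrite y0 op0 mulr0 mul0r /msum [X in _ = X + _]big1 ?add0r; last first.
      by move=> i _; rewrite mulr0.
    by rewrite big1 // => i _; rewrite T_0 raddf0 mul0r.
  have Db := coideal_addl aE Da.
  rewrite -mulr_msuml -!IHn //; try exact: leq_trans ba an.
  by rewrite -!mulrA y_comm mulrDr.
(* Regroup so that the inner sums are the right-hand sides of [T_ode] and of $\chi(r) = r y$. *)
transitivity (msum a (fun b c => msum b (fun b1 b2 => h (T b1 (op b2 m)) * r c)
    + msum c (fun c1 c2 => h (T b m) * (r c1 * y c2)))).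
  rewrite !msum_split addrC; congr (_ + _).
    rewrite (msumA a (fun b1 b2 c => h (T b1 (op c m)) * r b2)).
    rewrite (msumA a (fun b1 b2 c => h (T b1 (op b2 m)) * r c)).
    by apply: eq_msum => b c _; rewrite msumC.
  rewrite (msumA a (fun b1 b2 c => h (T b1 m) * r b2 * y c)).
  by apply: eq_msum => b c _; apply: eq_msum => *; rewrite mulrA.
apply: eq_msum => b c aE; have Db := coideal_addl aE Da.
have Dc := coideal_addr aE Da.
rewrite -mulr_msuml -msum_morph -T_ode // -mulr_msumr -coefM // -rE coef_chi.
by rewrite raddfMn aE mdegD mulrnDr mulrnAl mulrnAr.
Qed.

Lemma intertwine x : r * tmap h x = tmap h (tfam T x) * r.
Proof. exact/intertwine_series/intertwine_coef. Qed.

End Intertwine.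

(** * Conjugation of derivations by Hasse-Schmidt derivations *)

Section Conjugation.
Variables (k A : comPzRingType) (eta : {rmorphism k -> A}).

Fact der_end_is_zmod : zmod_morphism (@der_end k A eta).
Proof. by []. Qed.
HB.instance Definition _ :=
  GRing.isZmodMorphism.Build (derivation eta) (kend eta) (@der_end k A eta)
    der_end_is_zmod.

Lemma lie_bracket0 (d : derivation eta) : lie_bracket 0 d = 0.
Proof. by apply: derP; rewrite /= mul0r mulr0 subrr. Qed.

(** Through this instance, results on LR-admissible maps apply to $D$ itself, as a solution in
    $\mathrm{End}_k(A)[[\mathbf{s}]]_\Delta$. *)
Lemma LR_kmult : LR_admissible (kmult eta) (@der_end k A eta).
Proof.
split=> // d a; apply: kendP => x; rewrite kendDE !kendME /=.
by rewrite der_leibniz addrC.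
Qed.

Definition tbracket p (Delta : coideal p) (x y : tseries Delta (derivation eta)) :
    tseries Delta (derivation eta) :=
  trunc Delta (fun a => msum a (fun b c => lie_bracket (x b) (y c))).

Lemma tmap_bracket p (Delta : coideal p) (R : pzRingType) (iota : {rmorphism A -> R})
  (nabla : {additive derivation eta -> R}) (x y : tseries Delta (derivation eta)) :
  LR_admissible iota nabla ->
  tmap nabla (tbracket x y) =
  tmap nabla x * tmap nabla y - tmap nabla y * tmap nabla x.
Proof.
move=> LR; apply: tseriesP => a Da; rewrite coef_tmap coefB !coefM // trunc_in //.
rewrite [X in _ - X]msumC msum_morph; apply/eqP.
rewrite eq_sym subr_eq -msum_split; apply/eqP; apply: eq_msum => b c _.
by rewrite !coef_tmap (LR_bracket LR) subrK.
Qed.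

Section Conj.
Variables (p : nat) (Delta : coideal p) (E : HS eta Delta).

(** $E$ acts on $A[[\mathbf{s}]]_\Delta$ by a ring automorphism, and conjugating a derivation by an
    automorphism gives a derivation. *)
Fact HS_conj_leibniz d a x y :
  let C := (useries_val (HS_val E) * tconst Delta (der_end d) *
             useries_val (HS_val E)^-1%g) a in
  C (x * y) = C x * y + x * C y.
Proof.
pose G := useries_val (HS_val E) * tconst Delta (der_end d) *
  useries_val (HS_val E)^-1%g.
rewrite -/G /= -!(tact_const G) rmorphM.
have KV f : tact (HS_val E) (tact (HS_val E)^-1%g f) = f.
  by rewrite -tactM -useries_mulE mulgV tact1.
have dM f g : tact (tconst Delta (der_end d)) (f * g) =
    tact (tconst Delta (der_end d)) f * g + f * tact (tconst Delta (der_end d)) g.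
  apply: tseriesP => a' Da.
  have td f' a1 : tact (tconst Delta (der_end d)) f' a1 = d (f' a1).
    have [Da1|nDa1] := pselect (Delta a1); last by rewrite !coef_out ?raddf0.
    rewrite trunc_in // msum0l ?coef_const ?eqxx // => b c /negPf b0.
    by rewrite coef_const b0.
  rewrite coefD !coefM // td coefM // msum_morph -msum_split.
  by apply: eq_msum => b c _; rewrite !td /= der_leibniz.
by rewrite !tactM HS_actV dM tactD !HS_act !KV coefD coefMc coefcM.
Qed.

Definition HS_conj a d : derivation eta := Derivation (HS_conj_leibniz d a).

Lemma HS_conjE d a : der_end (HS_conj a d) =
  (useries_val (HS_val E) * tconst Delta (der_end d) *
             useries_val (HS_val E)^-1%g) a.
Proof. by []. Qed.

Lemma tfam_conj (x : tseries Delta (derivation eta)) :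
  useries_val (HS_val E) * tmap (@der_end k A eta) x =
  tmap (@der_end k A eta) (tfam HS_conj x) * useries_val (HS_val E).
Proof.
apply: intertwine_series => a m Da.
transitivity ((useries_val (HS_val E) * tconst Delta (der_end m)) a).
  by rewrite coefMc.
rewrite -[_ * _]mulr1 -(useries_oneE Delta) -(mulVg (HS_val E)).
by rewrite useries_mulE mulrA coefM.
Qed.

End Conj.
End Conjugation.

Section UnitSeries.
Variables (p : nat) (Delta : coideal p) (R : pzRingType).
Implicit Types r s : useries Delta R.

Lemma useries_mulVr r : useries_val (r^-1)%g * useries_val r = 1.
Proof. by rewrite -useries_mulE mulVg. Qed.

Lemma useries_mulrV r : useries_val r * useries_val (r^-1)%g = 1.
Proof. by rewrite -useries_mulE mulgV. Qed.

Lemma chi_eps r : chi r = useries_val r * eps r.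
Proof. by rewrite /eps mulrA useries_mulrV mul1r. Qed.

Lemma eps_eq r y : chi r = useries_val r * y -> eps r = y.
Proof. by move=> rE; rewrite /eps rE mulrA useries_mulVr mul1r. Qed.

Lemma chi1 : chi (1 : tseries Delta R) = 0.
Proof. by rewrite -(rmorph1 (tconst Delta)) chi_const. Qed.

Lemma der_inv r (der : tseries Delta R -> tseries Delta R) :
  (forall u v, der (u * v) = der u * v + u * der v) -> der 1 = 0 ->
  der (useries_val (r^-1)%g) =
  - (useries_val (r^-1)%g * der r * useries_val (r^-1)%g).
Proof.
move=> derM der1; apply/eqP; rewrite -addr_eq0; apply/eqP.
have := congr1 (fun u => u * useries_val (r^-1)%g) (derM (useries_val (r^-1)%g) r).
by rewrite useries_mulVr der1 mul0r mulrDl -!mulrA useries_mulrV mulr1 !mulrA => <-.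
Qed.

End UnitSeries.

(** * Commutation and products of solutions *)

Section Solutions.
Variables (k A : comPzRingType) (eta : {rmorphism k -> A}).
Variables (R : pzRingType) (ratR : {rmorphism rat -> R}).
Variables (iota : {rmorphism A -> R}) (nabla : {additive derivation eta -> R}).
Hypothesis LR : LR_admissible iota nabla.
Variables (p : nat) (Delta : coideal p).

Lemma chi_HS (D : HS eta Delta) :
  chi (HS_val D) = useries_val (HS_val D) * tmap (@der_end k A eta) (HS_eps D).
Proof.
rewrite chi_eps; congr (_ * _).
by apply: tseriesP => a _; rewrite coef_tmap.
Qed.

(** Intertwining with [h] the map [iota], [T] the coefficients of [E] and [op] those of [delta]. [E]
    ranges over all solutions in $\mathrm{End}_k(A)$, so that [HS_of_eps_leibniz] can use the lemma
    to show that such an [E] is an HS-derivation. *)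
Lemma sol_comm (delta : tseries Delta (derivation eta))
    (E : tseries Delta (kend eta)) (r : tseries Delta R) :
  delta 0%MM = 0 -> E 0%MM = 1 -> r 0%MM = 1 ->
  chi E = E * tmap (@der_end k A eta) delta -> chi r = r * tmap nabla delta ->
  forall x, r * tmap iota x = tmap iota (tact E x) * r.
Proof.
move=> d0 E0 r0 chiE chir x.
apply: (@intertwine _ _ _ ratR _ iota (fun a : 'X_{1..p} => coef E a) r
  (tmap nabla delta) (fun c m => delta c m)) => //.
- by rewrite coef_tmap d0 raddf0.
- by move=> m; rewrite d0.
- by move=> m; rewrite E0.
- by move=> a; rewrite raddf0.
- by move=> a m; rewrite coef_tmap (LR_comm LR).
move=> a m Da; rewrite -kendMnE -coef_chi chiE coefM // kend_sumE.
by apply: eq_bigr => b _; rewrite coef_tmap.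
Qed.

(** With $e = \varepsilon(E)$, the product rule gives $\chi(E d E^{-1}) = E [e, d] E^{-1}$. This is
    the hypothesis [T_ode] for conjugation. *)
Lemma HS_conj_ode (E : HS eta Delta) a d : Delta a ->
  HS_conj E a d *+ mdeg a =
  msum a (fun b c => HS_conj E b (lie_bracket (HS_eps E c) d)).
Proof.
move=> Da; pose e := HS_eps E; pose v := useries_val (HS_val E).
pose w := useries_val (HS_val E)^-1%g.
pose dd := tconst Delta (der_end d).
have chiw : chi w = - (tmap (@der_end k A eta) e * w).
  rewrite /w der_inv ?chi1 //; last exact: chiM.
  by rewrite chi_HS [X in - (X * _)]mulrA useries_mulVr mul1r.
have chiC : chi (v * dd * w) =
    tmap (@der_end k A eta) (tfam (HS_conj E) (tbracket e (tconst Delta d))).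
  rewrite -[RHS]mulr1 -(useries_mulrV (HS_val E)) [RHS]mulrA -tfam_conj.
  rewrite (tmap_bracket _ _ (LR_kmult eta)) tmap_const.
  rewrite !chiM chi_HS chi_const mulr0 addr0 chiw.
  by rewrite !(mulrBr, mulrBl) mulrN !mulrA.
apply: (@derP _ _ eta); rewrite raddfMn /= -coef_chi -/v -/w -/dd chiC.
rewrite coef_tmap trunc_in //; congr der_end; apply: eq_msum => b c aE.
congr (HS_conj E b _); rewrite trunc_in; last exact: coideal_addr aE Da.
rewrite msum0r ?coef_const ?eqxx // => b' c' /negPf c0.
by rewrite coef_const c0 mulr0n; apply: derP; rewrite /= mulr0 mul0r subrr.
Qed.

Lemma HS_conj0 (E : HS eta Delta) a : HS_conj E a 0 = 0.
Proof. by apply: derP; rewrite /= [tconst _ _]raddf0 mulr0 mul0r coef0. Qed.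

Lemma HS_conj_at0 (E : HS eta Delta) d : HS_conj E 0%MM d = d.
Proof.
apply: derP; rewrite HS_conjE !coefM_at0 !useries_at0 coef_const eqxx.
by rewrite mul1r mulr1.
Qed.

(** Here [x] is $E^{-1} \varepsilon(D) E$, written as a difference so that its coefficients are
    derivations by construction. Intertwining gives $s N(x) = N(\varepsilon(D)) s$, with $N$ the
    extension of [nabla], so $\chi(r s) = r s N(x + \varepsilon(E))$. *)
Lemma sol_mul (D E : HS eta Delta) (r s : tseries Delta R) :
  s 0%MM = 1 ->
  chi r = r * tmap nabla (HS_eps D) -> chi s = s * tmap nabla (HS_eps E) ->
  chi (r * s) = r * s * tmap nabla (HS_eps (D * E)%g).
Proof.
move=> s0 rE sE; pose x := HS_eps (D * E)%g - HS_eps E.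
have conjx : tfam (HS_conj E) x = HS_eps D.
  apply: (@tmap_inj _ _ _ _ (@der_end k A eta)); first exact: derP.
  rewrite -[LHS]mulr1 -(useries_mulrV (HS_val E)) mulrA -tfam_conj.
  rewrite raddfB /= mulrBr -chi_HS.
  have : useries_val (HS_val D) * (useries_val (HS_val E) *
      tmap (@der_end k A eta) (HS_eps (D * E)%g)) =
    useries_val (HS_val D) * (tmap (@der_end k A eta) (HS_eps D) *
      useries_val (HS_val E) + chi (HS_val E)).
    rewrite mulrA -[useries_val _ * useries_val _](useries_mulE (HS_val D)).
    by rewrite -HS_mulE -chi_HS HS_mulE chiM [chi (HS_val D)]chi_HS mulrDr mulrA.
  move/(congr1 (fun u => useries_val (HS_val D)^-1%g * u)).
  rewrite !mulrA useries_mulVr !mul1r => ->.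
  by rewrite addrK -mulrA useries_mulrV mulr1.
have sx : s * tmap nabla x = tmap nabla (HS_eps D) * s.
  rewrite -conjx; apply: (@intertwine _ _ _ ratR _ nabla _ s
    (tmap nabla (HS_eps E)) (fun c m => lie_bracket (HS_eps E c) m)) => //.
  - by rewrite coef_tmap HS_eps_at0 raddf0.
  - by move=> m; rewrite HS_eps_at0 lie_bracket0.
  - exact: HS_conj_at0.
  - exact: HS_conj0.
  - by move=> a m; rewrite coef_tmap (LR_bracket LR) addrC subrK.
  - exact: HS_conj_ode.
rewrite chiM rE sE -[r * _ * s]mulrA -sx [r * (s * _)]mulrA [r * (s * _)]mulrA.
by rewrite -mulrDr -raddfD /= subrK.
Qed.

End Solutions.

(** * Partial derivatives *)

Section Partial.
Variable p : nat.
Implicit Types (i : 'I_p) (a b c : 'X_{1..p}).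

Lemma msum_pick (M : nmodType) (u f : 'X_{1..p}) (H : 'X_{1..p} -> M) :
  msum (u + f)%MM (fun b c => if b == u then H c else 0) = H f.
Proof.
set N := (mdeg (u + f)%MM).+1.
have lu : (mdeg u < N)%N by rewrite ltnS mdegD leq_addr.
have lf : (mdeg f < N)%N by rewrite ltnS mdegD leq_addl.
rewrite (msumE _ (ltnSn _)) (bigD1 (BMultinom lu)) //=.
rewrite [X in _ + X]big1 ?addr0 => [|b]; last first.
  rewrite -(inj_eq val_inj) /= => /negPf bu.
  by rewrite big1 // => c _; rewrite bu if_same.
rewrite (bigD1 (BMultinom lf)) //= !eqxx big1 ?addr0 // => c.
by rewrite -(inj_eq val_inj) /= eqm_add2l eq_sym => /negPf ->.
Qed.

Lemma mnm_subUK (a : 'X_{1..p}) i : a i != 0%N -> (U_(i) + (a - U_(i)))%MM = a.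
Proof. by move=> ai; rewrite addmC submK // lep1mP. Qed.

(** Inserting a factor concentrated at $e_i$ makes the reindexing an instance of [msumA]. *)
Lemma msum_shiftl (M : nmodType) i a (F : 'X_{1..p} -> 'X_{1..p} -> M) :
  (forall b c, b i = 0%N -> F b c = 0) ->
  msum (U_(i) + a)%MM F = msum a (fun b c => F (U_(i) + b)%MM c).
Proof.
move=> F0.
pose G u v c := if u == U_(i)%MM then F (U_(i) + v)%MM c else 0.
rewrite -(msum_pick U_(i)%MM a (fun f => msum f (fun v c => F (U_(i) + v)%MM c))).
transitivity (msum (U_(i) + a)%MM (fun u f => msum f (fun v c => G u v c))).
  rewrite -(msumA _ G); apply: eq_msum => b c _.
  have [bi|bi] := eqVneq (b i) 0%N.
    rewrite F0 // /msum big1 // => h /eqP bE; rewrite /G; case: eqP => // hU.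
    by have := congr1 (fun m : 'X_{1..p} => m i) bE; rewrite bi mnmDE hU mnm1E eqxx.
  by rewrite -{2}(mnm_subUK bi) (msum_pick _ _ (fun v => F (U_(i) + v)%MM c))
    mnm_subUK.
apply: eq_msum => u f _; rewrite /G; case: eqP => // _.
by rewrite /msum big1.
Qed.

Lemma msum_shiftr (M : nmodType) i a (F : 'X_{1..p} -> 'X_{1..p} -> M) :
  (forall b c, c i = 0%N -> F b c = 0) ->
  msum (U_(i) + a)%MM F = msum a (fun b c => F b (U_(i) + c)%MM).
Proof.
by move=> F0; rewrite msumC msum_shiftl => [|b c]; [exact: msumC | exact: F0].
Qed.

(** The Leibniz rule for $\partial_i$: on the left $b_i + c_i = a_i + 1$, so the weight splits, and
    terms of weight 0 drop out of each half. *)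
Lemma msum_pd (M : nmodType) i a (F : 'X_{1..p} -> 'X_{1..p} -> M) :
  msum (U_(i) + a)%MM F *+ (a i).+1 =
  msum a (fun b c => F (U_(i) + b)%MM c *+ (b i).+1) +
  msum a (fun b c => F b (U_(i) + c)%MM *+ (c i).+1).
Proof.
transitivity (msum (U_(i) + a)%MM (fun b c => F b c *+ b i) +
              msum (U_(i) + a)%MM (fun b c => F b c *+ c i)).
  rewrite msumMn -msum_split; apply: eq_msum => b c aE; rewrite -mulrnDr -mnmDE -aE.
  by rewrite mnmDE mnm1E eqxx.
rewrite msum_shiftl => [|b c /= ->]; last by rewrite mulr0n.
rewrite msum_shiftr => [|b c /= ->]; last by rewrite mulr0n.
by congr (_ + _); apply: eq_msum => b c _; rewrite mnmDE mnm1E eqxx.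
Qed.

(** Partial derivatives live on $\mathbb{N}^p$: their coefficient at $a$ is read at $a + e_i$, which
    may leave a smaller co-ideal. *)
Definition full : coideal p.
Proof. by exists (fun=> True) => //; exists 0%MM. Defined.

Definition pd (M : nmodType) i (r : tseries full M) : tseries full M :=
  trunc full (fun a => r (U_(i) + a)%MM *+ (a i).+1).

Lemma coef_pd (M : nmodType) i (r : tseries full M) a :
  pd i r a = r (U_(i) + a)%MM *+ (a i).+1.
Proof. exact: trunc_in. Qed.

Lemma pd_is_zmod (M : zmodType) i : zmod_morphism (@pd M i).
Proof.
by move=> r s; apply: tseriesP => a _; rewrite coefB !coef_pd coefB mulrnBl.
Qed.
HB.instance Definition _ (M : zmodType) i :=
  GRing.isZmodMorphism.Build (tseries full M) (tseries full M) (@pd M i)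
    (@pd_is_zmod M i).

Lemma pd_const (M : zmodType) i (m : M) : pd i (tconst full m) = 0.
Proof.
apply: tseriesP => a _; rewrite coef_pd coef0 coef_const mnmD_eq0 mnm1_eq0.
by rewrite mulr0n mul0rn.
Qed.

Lemma pd_tmap (M N : zmodType) (f : {additive M -> N}) i (r : tseries full M) :
  pd i (tmap f r) = tmap f (pd i r).
Proof. by apply: tseriesP => a _; rewrite coef_pd !coef_tmap coef_pd raddfMn. Qed.

Lemma chi_pd (M : zmodType) i (r : tseries full M) :
  chi (pd i r) = pd i (chi r) - pd i r.
Proof.
apply/eqP; rewrite eq_sym subr_eq; apply/eqP.
apply: tseriesP => a _; rewrite coefD !(coef_chi, coef_pd) mdegD mdeg1.
by rewrite mulrnAC -mulrSr -!mulrnA mulnC.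
Qed.

Lemma pdM (R : pzRingType) i (r s : tseries full R) :
  pd i (r * s) = pd i r * s + r * pd i s.
Proof.
apply: tseriesP => a Da; rewrite coefD !coefM // coef_pd coefM // msum_pd.
by congr (_ + _); apply: eq_msum => b c _; rewrite coef_pd (mulrnAl, mulrnAr).
Qed.

Lemma pd1 (R : pzRingType) i : pd i (1 : tseries full R) = 0.
Proof. by rewrite -(rmorph1 (tconst full)) pd_const. Qed.

Variables (k A : comPzRingType) (eta : {rmorphism k -> A}).
Implicit Type D : HS eta full.

Lemma tact_pd i (E : tseries full (kend eta)) f :
  tact (pd i E) f = pd i (tact E f) - tact E (pd i f).
Proof.
apply/eqP; rewrite eq_sym subr_eq; apply/eqP.
apply: tseriesP => a Da; rewrite coefD coef_pd !trunc_in // msum_pd.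
congr (_ + _); apply: eq_msum => b c _.
  by rewrite coef_pd kendMnE.
by rewrite coef_pd raddfMn.
Qed.

(** Since $\partial_i$ kills constants, this series acts on them as the conjugate of the derivation
    $\partial_i$ by the automorphism $D$. *)
Lemma HS_pd_leibniz i D a x y :
  let C := (useries_val (HS_val D)^-1%g * pd i (HS_val D)) a in
  C (x * y) = C x * y + x * C y.
Proof.
pose G := useries_val (HS_val D)^-1%g * pd i (HS_val D).
rewrite -/G /= -!(tact_const G) rmorphM.
have VK f : tact (HS_val D)^-1%g (tact (HS_val D) f) = f.
  by rewrite -tactM -useries_mulE mulVg tact1.
have tactG f : tact G (tconst full f) =
    tact (HS_val D)^-1%g (pd i (tact (HS_val D) (tconst full f))).
  have tact0 : tact (HS_val D) 0 = 0.
    by apply: (addIr (tact (HS_val D) 0)); rewrite -tactD !add0r.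
  by rewrite tactM tact_pd pd_const tact0 subr0.
rewrite -(rmorphM (tconst full)) !tactG rmorphM HS_act pdM tactD !HS_actV !VK.
by rewrite coefD coefMc coefcM.
Qed.

Definition HS_pd i D : tseries full (derivation eta) :=
  trunc full (fun a => Derivation (HS_pd_leibniz i D a)).

Lemma HS_pdE i D :
  tmap (@der_end k A eta) (HS_pd i D) =
  useries_val (HS_val D)^-1%g * pd i (HS_val D).
Proof. by apply: tseriesP => a Da; rewrite coef_tmap trunc_in. Qed.

(** A zero-curvature relation between the logarithmic derivatives of $D$ along $\chi$ and
    $\partial_i$, which satisfy $\chi \partial_i = \partial_i \chi - \partial_i$. *)
Lemma chi_HS_pd i D :
  chi (HS_pd i D) = tbracket (HS_pd i D) (HS_eps D) + pd i (HS_eps D) - HS_pd i D.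
Proof.
apply: (@tmap_inj _ _ _ _ (@der_end k A eta)); first exact: derP.
rewrite raddfB raddfD /= tmap_chi -pd_tmap (tmap_bracket _ _ (LR_kmult eta)) HS_pdE.
rewrite chiM chi_pd chi_HS pdM der_inv ?chi1 //; last exact: chiM.
rewrite chi_HS [X in - (X * _) * _]mulrA useries_mulVr mul1r.
rewrite mulrBr mulrDr [_ * (useries_val _ * _)]mulrA useries_mulVr mul1r mulNr !mulrA.
rewrite [LHS]addrC -!addrA; congr (_ + _).
by rewrite [RHS]addrC -!addrA.
Qed.

(** By [chi_HS_pd], the difference $v$ of the two sides satisfies $\chi(v) + v = v
    N(\varepsilon(D))$, with $N$ the extension of [nabla]. *)
Lemma sol_pd (R : pzRingType) (ratR : {rmorphism rat -> R})
    (iota : {rmorphism A -> R}) (nabla : {additive derivation eta -> R})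
    (LR : LR_admissible iota nabla) D (r : tseries full R) i :
  chi r = r * tmap nabla (HS_eps D) -> pd i r = r * tmap nabla (HS_pd i D).
Proof.
move=> rE; apply/eqP; rewrite -subr_eq0; apply/eqP.
(* With $k = 1$ the factor $|a| + 1$ is positive at $a = 0$ too, so the constant term of $v$ also
   vanishes. *)
apply: (@ode_eq0 _ ratR _ _ 1 _ (tmap nabla (HS_eps D))) => //.
  by rewrite coef_tmap HS_eps_at0 raddf0.
rewrite raddfB /= chi_pd rE chiM -tmap_chi chi_HS_pd.
rewrite [tmap nabla (_ - _)]raddfB /= [tmap nabla (_ + _)]raddfD /=.
rewrite (tmap_bracket _ _ LR) pdM pd_tmap rE mulr1n.
set w := tmap nabla _; set e := tmap nabla _; set q := tmap nabla _.
rewrite !(mulrDr, mulrN, mulrBl) !mulrA.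
set u := pd i r * w; set v := r * w * e; set t := r * e * w; set z := r * e.
have -> : v + (t - v + r * q - z) = t + (r * q - z).
  by rewrite -!addrA addrCA addNKr.
rewrite [u + _ - _ - _]addrAC subrKA [t + _]addrCA.
by rewrite addrKA opprB -addrA [z - t - z]addrAC subrr sub0r.
Qed.
End Partial.

(** * Infinite sums and the chain rule *)

Lemma mdeg_lel p (a b c : 'X_{1..p}) : a = (b + c)%MM -> (mdeg b <= mdeg a)%N.
Proof. by move=> ->; rewrite mdegD leq_addr. Qed.

Lemma mdeg_ler p (a b c : 'X_{1..p}) : a = (b + c)%MM -> (mdeg c <= mdeg a)%N.
Proof. by move=> ->; rewrite mdegD leq_addl. Qed.

Section Summation.
Variables (p q : nat) (Omega : coideal q).
Implicit Types (a b : 'X_{1..p}) (w : 'X_{1..q}).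

Definition summable (N : nmodType) (c : 'X_{1..p} -> tseries Omega N) :=
  forall a w, (mdeg w < mdeg a)%N -> c a w = 0.

(** For a summable family the cut-off $|a| \le |w|$ omits only zero terms. *)
Definition tsum (N : nmodType) (c : 'X_{1..p} -> tseries Omega N) : tseries Omega N :=
  trunc Omega (fun w => \sum_(a : 'X_{1..p < (mdeg w).+1}) c a w).

Lemma tsumE (N : nmodType) n (c : 'X_{1..p} -> tseries Omega N) w :
  summable c -> (mdeg w < n)%N -> tsum c w = \sum_(a : 'X_{1..p < n}) c a w.
Proof.
move=> cS wn; have [Ow|nOw] := pselect (Omega w); last first.
  by rewrite coef_out // big1 // => a _; rewrite coef_out.
have toP m : (mdeg w < m)%N -> \sum_(a : 'X_{1..p < m}) c a w =
    \sum_(a : 'X_{1..p < m} | (mdeg a <= mdeg w)%N) c a w.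
  move=> _; rewrite [RHS]big_mkcond; apply: eq_bigr => a _.
  by case: leqP => // /cS.
rewrite trunc_in // toP // [RHS]toP //.
apply: (sum_bnd (P := fun b => (mdeg b <= mdeg w)%N) (fun a => c a w)) => b bw.
by rewrite ltnS bw (leq_ltn_trans bw).
Qed.

Lemma eq_tsum (N : nmodType) (c d : 'X_{1..p} -> tseries Omega N) :
  (forall a, c a = d a) -> tsum c = tsum d.
Proof.
move=> cd; apply: tseriesP => w Ow; rewrite !trunc_in //.
by apply: eq_bigr => a _; rewrite cd.
Qed.

Lemma tsum_sum (N : zmodType) (I : finType) (c : I -> 'X_{1..p} -> tseries Omega N) :
  tsum (fun a => \sum_i c i a) = \sum_i tsum (c i).
Proof.
apply: tseriesP => w Ow; rewrite coef_sum trunc_in //.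
under eq_bigr do rewrite coef_sum.
by rewrite exchange_big; apply: eq_bigr => i _; rewrite trunc_in.
Qed.

Lemma chi_tsum (N : zmodType) (c : 'X_{1..p} -> tseries Omega N) :
  chi (tsum c) = tsum (fun a => chi (c a)).
Proof.
apply: tseriesP => w Ow; rewrite coef_chi !trunc_in // -sumrMnl.
by apply: eq_bigr => a _; rewrite coef_chi.
Qed.

Lemma tmap_tsum (M N : zmodType) (f : {additive M -> N})
    (c : 'X_{1..p} -> tseries Omega M) :
  tmap f (tsum c) = tsum (fun a => tmap f (c a)).
Proof.
apply: tseriesP => w Ow; rewrite coef_tmap !trunc_in // raddf_sum.
by apply: eq_bigr => a _; rewrite coef_tmap.
Qed.

Section Ring.
Variable R : pzRingType.
Implicit Type c : 'X_{1..p} -> tseries Omega R.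

Lemma mul_small_r n (x y : tseries Omega R) w :
  (forall v, (mdeg v < n)%N -> y v = 0) -> (mdeg w < n)%N -> (x * y) w = 0.
Proof.
move=> y0 wn; have [Ow|nOw] := pselect (Omega w); last by rewrite coef_out.
rewrite coefM // /msum big1 // => h /eqP wE; rewrite y0 ?mulr0 //.
exact: leq_ltn_trans (mdeg_ler wE) wn.
Qed.

Lemma mul_small_l n (x y : tseries Omega R) w :
  (forall v, (mdeg v < n)%N -> x v = 0) -> (mdeg w < n)%N -> (x * y) w = 0.
Proof.
move=> x0 wn; have [Ow|nOw] := pselect (Omega w); last by rewrite coef_out.
rewrite coefM // /msum big1 // => h /eqP wE; rewrite x0 ?mul0r //.
exact: leq_ltn_trans (mdeg_lel wE) wn.
Qed.

Lemma summable_mull c x : summable c -> summable (fun a => x * c a).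
Proof. by move=> cS a w; apply: mul_small_r; apply: cS. Qed.

Lemma summable_mulr c x : summable c -> summable (fun a => c a * x a).
Proof. by move=> cS a w; apply: mul_small_l; apply: cS. Qed.

Lemma tsum_mull c x : summable c -> x * tsum c = tsum (fun a => x * c a).
Proof.
move=> cS; apply: tseriesP => w Ow; rewrite (tsumE (summable_mull _ cS) (ltnSn _)).
under eq_bigr do rewrite coefM //.
rewrite coefM // /msum exchange_big; apply: eq_bigr => h /eqP wE.
rewrite (@tsumE _ (mdeg w).+1) ?mulr_sumr //.
by rewrite ltnS (mdeg_ler wE).
Qed.

Lemma tsum_mulr c x : summable c -> tsum c * x = tsum (fun a => c a * x).
Proof.
move=> cS; have cS' : summable (fun a => c a * x) := summable_mulr (fun=> x) cS.
apply: tseriesP => w Ow; rewrite (tsumE cS' (ltnSn _)).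
under eq_bigr do rewrite coefM //.
rewrite coefM // /msum exchange_big; apply: eq_bigr => h /eqP wE.
rewrite (@tsumE _ (mdeg w).+1) ?mulr_suml //.
by rewrite ltnS (mdeg_lel wE).
Qed.

End Ring.

(** By the bound on orders only finitely many pairs contribute at each $w$, so the double sum may be
    regrouped by $a = b + c$. *)
Lemma tsum_conv (N : zmodType) (F : 'X_{1..p} -> 'X_{1..p} -> tseries Omega N) :
  (forall a b w, (mdeg w < mdeg a + mdeg b)%N -> F a b w = 0) ->
  tsum (fun a => msum a F) = tsum (fun b => tsum (fun c => F b c)).
Proof.
move=> FS; have FS1 a : summable (F a).
  by move=> b w wb; apply: FS; rewrite (leq_trans wb) ?leq_addl.
have FS2 : summable (fun b => tsum (F b)).
  move=> b w wb; rewrite (tsumE (FS1 b) (ltnSn _)) big1 // => c _.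
  by apply: FS; rewrite (leq_trans wb) ?leq_addr.
have coef_msum a w : msum a F w = msum a (fun b c => F b c w).
  by rewrite /msum coef_sum.
apply: tseriesP => w Ow; rewrite (tsumE FS2 (ltnSn _)) trunc_in //.
set n := (mdeg w).+1.
transitivity (\sum_(a : 'X_{1..p < n}) \sum_(b : 'X_{1..p < n})
    \sum_(c : 'X_{1..p < n}) (if (a : 'X_{1..p}) == (b + c)%MM then F b c w else 0)).
  apply: eq_bigr => a _; rewrite coef_msum (@msumE _ _ n) //; exact: bmdeg.
rewrite exchange_big; apply: eq_bigr => b _; rewrite exchange_big.
rewrite (tsumE (FS1 b) (ltnSn _)); apply: eq_bigr => c _ /=.
have [bcn|bcn] := ltnP (mdeg (b + c)%MM) n.
  rewrite (bigD1 (BMultinom bcn)) //= eqxx big1 ?addr0 // => a.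
  by rewrite -(inj_eq val_inj) /= => /negPf ->.
by rewrite FS -?mdegD // big1 // => a _; case: eqP.
Qed.

Lemma tsum_pick (N : zmodType) b (x : tseries Omega N) :
  (forall w, (mdeg w < mdeg b)%N -> x w = 0) ->
  tsum (fun a => if a == b then x else 0) = x.
Proof.
move=> xS; have cS : summable (fun a => if a == b then x else 0).
  by move=> a w wa; case: eqP wa => [->|_ _]; [apply: xS | rewrite coef0].
(* The bound exceeds both $|w|$ and $|b|$, so that $b$ occurs in the finite sum. *)
apply: tseriesP => w Ow; have wn : (mdeg w < mdeg w + mdeg b + 1)%N.
  by rewrite addn1 ltnS leq_addr.
have bn : (mdeg b < mdeg w + mdeg b + 1)%N by rewrite addn1 ltnS leq_addl.
rewrite (tsumE cS wn) (bigD1 (BMultinom bn)) //= eqxx big1 ?addr0 // => a.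
by rewrite -(inj_eq val_inj) /= => /negPf ->; rewrite coef0.
Qed.

(** As in [msum_shiftl], a factor concentrated at $e_i$ turns the shift into a regrouping by
    [tsum_conv]. *)
Lemma tsum_shift (N : zmodType) i (c : 'X_{1..p} -> tseries Omega N) :
  summable c -> (forall a, a i = 0%N -> c a = 0) ->
  tsum c = tsum (fun a => c (U_(i) + a)%MM).
Proof.
move=> cS c0; pose F b d := if b == U_(i)%MM then c (U_(i) + d)%MM else 0.
transitivity (tsum (fun a => msum a F)).
  apply: eq_tsum => a; have [ai|ai] := eqVneq (a i) 0%N.
    rewrite c0 // /msum big1 // => h /eqP aE; rewrite /F; case: eqP => // hU.
    by have := congr1 (fun m : 'X_{1..p} => m i) aE; rewrite ai mnmDE hU mnm1E eqxx.
  by rewrite -{2}(mnm_subUK ai) (msum_pick _ _ (fun v => c (U_(i) + v)%MM)) mnm_subUK.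
rewrite tsum_conv => [|b d w wbd]; last first.
  by rewrite /F; case: eqP wbd => [->|_ _]; [rewrite -mdegD; apply: cS |
    rewrite coef0].
set x := RHS; rewrite -[x](@tsum_pick _ U_(i)%MM) => [|w wU].
  apply: eq_tsum => b; rewrite /F; case: eqP => // _.
  by apply: tseriesP => w Ow; rewrite trunc_in // big1 ?coef0 // => d _;
    rewrite coef0.
have [Ow|nOw] := pselect (Omega w); last by rewrite coef_out.
rewrite trunc_in // big1 // => d _; apply: cS.
by rewrite mdegD (leq_trans wU) ?leq_addr.
Qed.

End Summation.

(** * Substitution into solutions over $\mathbb{N}^p$ *)

Section SubstFull.
Variables (p q : nat) (Omega : coideal q).
Variables (k A : comPzRingType) (eta : {rmorphism k -> A}).
Variable phi : substmap (full p) Omega A.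

Let P a := phi (tmon (full p) A a).

Lemma tmonD (R : pzRingType) (a b : 'X_{1..p}) :
  tmon (full p) R (a + b)%MM = tmon (full p) R a * tmon (full p) R b.
Proof.
apply: tseriesP => d Dd; rewrite coefM // [LHS]trunc_in //.
have tE (x y : 'X_{1..p}) : tmon (full p) R x y = (y == x)%:R by apply: trunc_in.
case: (eqVneq d (a + b)%MM) => [->|dab].
  transitivity (msum (a + b)%MM (fun u v =>
      if u == a then tmon (full p) R b v else 0)).
    by rewrite msum_pick tE eqxx.
  by apply: eq_msum => u v _; rewrite (tE a u); case: eqP => _; rewrite ?mul1r ?mul0r.
rewrite /msum big1 // => h /eqP dE; rewrite !tE.
do 2 case: eqP => //; rewrite ?mulr0 ?mul0r //.
by move=> bE aE; rewrite dE bE aE eqxx in dab.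
Qed.

Lemma substmap_tmonD a b : P (a + b)%MM = P a * P b.
Proof. by rewrite /P tmonD rmorphM. Qed.

Lemma substmap_tmon_summable : summable P.
Proof. by move=> a w; apply: substmap_mon_small. Qed.

(* Both sides are phi-derivations of A[[s]] that vanish on A and agree on the *)
(* variables.                                                                 *)
Lemma chi_substmap_tmon a : chi (P a) =
  \sum_i chi (phi (tvar (full p) A i)) * phi (pd i (tmon (full p) A a)).
Proof.
pose th f := \sum_i chi (phi (tvar (full p) A i)) * phi (pd i f).
rewrite -[RHS]/(th _).
have thM f g : th (f * g) = th f * phi g + phi f * th g.
  rewrite /th mulr_suml mulr_sumr -big_split; apply: eq_bigr => i _ /=.
  by rewrite pdM rmorphD !rmorphM mulrDr mulrA [phi f * (_ * _)]mulrCA.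
have th_var i : th (tvar (full p) A i) = chi (phi (tvar (full p) A i)).
  have pdv j : pd j (tvar (full p) A i) = (j == i)%:R.
    apply: tseriesP => d _; rewrite coef_pd trunc_in //.
    have -> : ((U_(j) + d)%MM == U_(i)%MM) = ((j == i) && (d == 0%MM)).
      have [->|d0] := eqVneq d 0%MM.
        by rewrite addm0 andbT eq_mnm1.
      rewrite andbF; apply/negP => /eqP/(congr1 (@mdeg p)).
      rewrite mdegD !mdeg1 => /eqP.
      by rewrite -[X in _ == X]addn0 eqn_add2l mdeg_eq0 (negPf d0).
    case: eqP => _ /=; last by rewrite coef0 mul0rn.
    by rewrite coef1; case: eqP => [->|]; rewrite ?mul0rn // mnm0E.
  rewrite /th (bigD1 i) //= pdv eqxx rmorph1 mulr1 big1 ?addr0 // => j /negPf ji.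
  by rewrite pdv ji rmorph0 mulr0.
have [n] := ubnP (mdeg a); elim: n a => // n IHn a; rewrite ltnS => an.
have [->|a0] := eqVneq a 0%MM.
  have -> : P 0%MM = 1 by rewrite /P -(rmorph1 phi).
  rewrite chi1 /th big1 // => i _.
  by rewrite [pd _ _]pd1 rmorph0 mulr0.
have [i ai] : exists i, a i != 0%N.
  apply/existsP; apply: contraNT a0; rewrite negb_exists => /forallP a0.
  by apply/eqP/mnmP => i; rewrite mnm0E; apply/eqP; have := a0 i; rewrite negbK.
rewrite -(mnm_subUK ai) substmap_tmonD tmonD thM chiM.
rewrite [th (tmon _ _ U_(i))]th_var [chi (P (a - _)%MM)]IHn //.
by apply: leq_trans an; rewrite -{2}(mnm_subUK ai) mdegD mdeg1.
Qed.

End SubstFull.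

Lemma mul_small q (Omega : coideal q) (R : pzRingType) m n (x y : tseries Omega R) w :
  (forall v, (mdeg v < m)%N -> x v = 0) -> (forall v, (mdeg v < n)%N -> y v = 0) ->
  (mdeg w < m + n)%N -> (x * y) w = 0.
Proof.
move=> x0 y0 wmn; have [Ow|nOw] := pselect (Omega w); last by rewrite coef_out.
rewrite coefM // /msum big1 // => h /eqP wE.
have [hm|hm] := ltnP (mdeg (h.1 : 'X_{1..q})) m; first by rewrite x0 ?mul0r.
rewrite y0 ?mulr0 //; have : (mdeg (h.1 + h.2)%MM < m + n)%N by rewrite -wE.
rewrite mdegD => /leq_trans; move/(_ (mdeg h.1 + n)%N).
by rewrite leq_add2r hm ltn_add2l => /(_ isT).
Qed.

Section SubstSol.
Variables (p q : nat) (Omega : coideal q).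
Variables (k A : comPzRingType) (eta : {rmorphism k -> A}).
Variable phi : substmap (full p) Omega A.
Variable D : HS eta (full p).

Let P a := phi (tmon (full p) A a).
Let psi i := chi (phi (tvar (full p) A i)).
Let E : HS eta Omega := HS_subst phi D.

(** The operator $E^{-1}$ is the price of carrying $\chi(\varphi(s_i)) \varphi(\mathbf{s}^c)$ to the
    right of $\varphi \bullet r$. [HS_eps_subst] identifies this series with $\varepsilon(\varphi
    \bullet D)$. *)
Definition subst_eps : tseries Omega (derivation eta) :=
  \sum_i tsum (fun c => trunc Omega (fun w =>
    tact (HS_val E)^-1%g (psi i * P c) w *: HS_pd i D c)).

Lemma phi_tsum f : phi f = tsum (fun a => P a * tconst Omega (f a)).
Proof.
apply: tseriesP => w Ow; rewrite substmapE trunc_in //.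
by apply: eq_bigr => a _; rewrite coefMc.
Qed.

Lemma tact_HS_subst x :
  tact (HS_val E) (tconst Omega x) = phi (tact (HS_val D) (tconst _ x)).
Proof.
apply: tseriesP => w Ow; rewrite tact_const substmapE trunc_in // kend_sumE.
by apply: eq_bigr => b _; rewrite kendME tact_const.
Qed.

Variables (R : pzRingType) (ratR : {rmorphism rat -> R}).
Variables (iota : {rmorphism A -> R}) (nabla : {additive derivation eta -> R}).
Hypothesis LR : LR_admissible iota nabla.
Implicit Types (r y : tseries (full p) R) (a : 'X_{1..p}).

Let Phi r := subst_act iota phi r.

Lemma tmap_substmap_small a w : (mdeg w < mdeg a)%N -> tmap iota (P a) w = 0.
Proof. by move=> wa; rewrite coef_tmap substmap_tmon_summable ?raddf0. Qed.

Lemma tmap_substmapM_small x a w : (mdeg w < mdeg a)%N -> (tmap iota (P a) * x) w = 0.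
Proof. by move=> wa; apply: mul_small_l wa => v; apply: tmap_substmap_small. Qed.

Lemma subst_actE r : Phi r = tsum (fun a => tmap iota (P a) * tconst Omega (r a)).
Proof.
apply: tseriesP => w Ow; rewrite !trunc_in //.
by apply: eq_bigr => a _; rewrite coefMc coef_tmap.
Qed.

Lemma tconst_msum a (F : 'X_{1..p} -> 'X_{1..p} -> R) :
  tconst Omega (msum a F) = msum a (fun b c => tconst Omega (F b c)).
Proof. exact: (raddf_sum (tconst Omega)). Qed.

Lemma subst_actM f r : Phi (tmap iota f * r) = tmap iota (phi f) * Phi r.
Proof.
rewrite !subst_actE phi_tsum tmap_tsum.
pose F b c := tmap iota (P b * tconst Omega (f b)) *
  (tmap iota (P c) * tconst Omega (r c)).
transitivity (tsum (fun a => msum a F)).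
  apply: eq_tsum => a; rewrite coefM // tconst_msum mulr_msumr.
  apply: eq_msum => b c ->; rewrite /F coef_tmap /P tmonD !rmorphM /=.
  rewrite -tmap_const -!mulrA; congr (_ * _); rewrite !mulrA; congr (_ * _).
  by rewrite -!rmorphM mulrC.
have FS b c w : (mdeg w < mdeg b + mdeg c)%N -> F b c w = 0.
  apply: mul_small => v vb; last exact: tmap_substmapM_small.
  by rewrite rmorphM tmap_substmapM_small.
rewrite tsum_conv // tsum_mulr => [|a w wa]; last first.
  by rewrite rmorphM tmap_substmapM_small.
apply: eq_tsum => b; rewrite tsum_mull // => a w; exact: tmap_substmapM_small.
Qed.

(** The action of $\varphi$ need not be multiplicative on $R[[\mathbf{s}]]$, because elements of $A$
    need not commute with $r$: the images of monomials collect on the left while $y_c$ stays on the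
    right. *)
Lemma subst_act_mulr r y :
  Phi (r * y) = tsum (fun c => tmap iota (P c) * Phi r * tconst Omega (y c)).
Proof.
rewrite !subst_actE.
pose F c b :=
  tmap iota (P c) * (tmap iota (P b) * tconst Omega (r b)) * tconst Omega (y c).
transitivity (tsum (fun a => msum a F)).
  apply: eq_tsum => a; rewrite coefM // tconst_msum mulr_msumr [RHS]msumC.
  apply: eq_msum => b c ->; rewrite /F addmC /P tmonD !rmorphM /=.
  by rewrite !mulrA.
have FS c b w : (mdeg w < mdeg c + mdeg b)%N -> F c b w = 0.
  rewrite /F -!mulrA; apply: mul_small => v vb; first exact: tmap_substmap_small.
  exact: tmap_substmapM_small.
have S : summable (fun b => tmap iota (P b) * tconst Omega (r b)).
  by move=> a w; apply: tmap_substmapM_small.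
rewrite tsum_conv //; apply: eq_tsum => c.
by rewrite tsum_mull // tsum_mulr //; apply: summable_mull.
Qed.

Lemma chi_substmap_small i w : (mdeg w < 1)%N -> tmap iota (psi i) w = 0.
Proof.
rewrite ltnS leqn0 => /eqP w0.
by rewrite coef_tmap coef_chi w0 mulr0n raddf0.
Qed.

(** The chain rule for monomials, summed against the constants $r_a$; the shift $a \mapsto e_i + a$
    transfers $\partial_i$ from the monomials to $r$. *)
Lemma chi_subst_act r :
  chi (Phi r) = \sum_i tmap iota (psi i) * Phi (pd i r).
Proof.
rewrite subst_actE chi_tsum.
pose c i a := tmap iota (psi i) *
  (tmap iota (phi (pd i (tmon (full p) A a))) * tconst Omega (r a)).
transitivity (tsum (fun a => \sum_i c i a)).
  apply: eq_tsum => a; rewrite chiM chi_const mulr0 addr0 -tmap_chi chi_substmap_tmon.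
  rewrite rmorph_sum mulr_suml; apply: eq_bigr => i _.
  by rewrite rmorphM -mulrA.
rewrite tsum_sum; apply: eq_bigr => i _.
have pd_tmon0 a : a i = 0%N -> pd i (tmon (full p) A a) = 0.
  move=> ai; apply: tseriesP => b _; rewrite coef_pd coef0 trunc_in //.
  case: eqP => [ba|_]; last by rewrite mul0rn.
  by have := congr1 (fun m : 'X_{1..p} => m i) ba; rewrite ai mnmDE mnm1E eqxx.
have pd_tmonS a :
    pd i (tmon (full p) A (U_(i) + a)%MM) = tmon (full p) A a *+ (a i).+1.
  apply: tseriesP => b _; rewrite coef_pd !trunc_in // eqm_add2l.
  have -> : (tmon (full p) A a *+ (a i).+1) b = tmon (full p) A a b *+ (a i).+1.
    by elim: (a i).+1 => [|n IHn]; rewrite ?coef0 // !mulrS coefD IHn.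
  by rewrite [in RHS]trunc_in //; case: eqP => [->|_] //; rewrite !mul0rn.
have c0 a : a i = 0%N -> c i a = 0.
  by move=> /pd_tmon0 ai; rewrite /c ai !rmorph0 mul0r mulr0.
have cE a : c i (U_(i) + a)%MM =
    tmap iota (psi i) * (tmap iota (P a) * tconst Omega (pd i r a)).
  by rewrite /c pd_tmonS coef_pd !raddfMn /= !(mulrnAl, mulrnAr).
rewrite (@tsum_shift _ _ _ _ i) // => [|a w wa].
  rewrite subst_actE tsum_mull => [|a w]; last exact: tmap_substmapM_small.
  exact: eq_tsum.
have [/c0->|ai] := eqVneq (a i) 0%N; first by rewrite coef0.
move: wa; rewrite -(mnm_subUK ai) cE mdegD mdeg1; apply: mul_small => v.
  exact: chi_substmap_small.
exact: tmap_substmapM_small.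
Qed.

Lemma tact_small n (f : tseries Omega A) w (F : tseries Omega (kend eta)) :
  (forall v, (mdeg v < n)%N -> f v = 0) -> (mdeg w < n)%N -> tact F f w = 0.
Proof.
move=> f0 wn; have [Ow|nOw] := pselect (Omega w); last by rewrite coef_out.
rewrite trunc_in // /msum big1 // => h /eqP wE; rewrite f0 ?raddf0 //.
exact: leq_ltn_trans (mdeg_ler wE) wn.
Qed.

(** Apply $\varphi$ to $r x = D(x) r$ for constant $x$, then extend to series by
    [intertwine_series]. *)
Lemma subst_act_comm r : r 0%MM = 1 -> chi r = r * tmap nabla (HS_eps D) ->
  forall x, Phi r * tmap iota x = tmap iota (tact (HS_val E) x) * Phi r.
Proof.
move=> r0 rE x.
apply: (@intertwine_series _ _ _ _ iota (fun a : 'X_{1..q} => coef (HS_val E) a)).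
move=> a m Oa; rewrite -coefMc.
have -> : Phi r * tconst Omega (iota m) = Phi (r * tmap iota (tconst _ m)).
  rewrite !subst_actE tsum_mulr => [|b w]; last exact: tmap_substmapM_small.
  apply: eq_tsum => b; rewrite -mulrA -rmorphM tmap_const coefMc //.
rewrite (sol_comm ratR LR (HS_eps_at0 D) (useries_at0 (HS_val D)) r0 (chi_HS D) rE).
rewrite subst_actM -tact_HS_subst coefM //; apply: eq_msum => b c _.
by rewrite coef_tmap tact_const.
Qed.

(** By the chain rule and [sol_pd], $\chi(\varphi \bullet r)$ is a sum of terms $\chi(\varphi(s_i))
    \varphi(\mathbf{s}^c) (\varphi \bullet r)$ times constants; [subst_act_comm] moves $\varphi
    \bullet r$ to the front. *)
Lemma sol_subst r : r 0%MM = 1 -> chi r = r * tmap nabla (HS_eps D) ->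
  chi (Phi r) = Phi r * tmap nabla subst_eps.
Proof.
move=> r0 rE; rewrite chi_subst_act raddf_sum mulr_sumr; apply: eq_bigr => i _.
rewrite (sol_pd ratR LR i rE) subst_act_mulr /= tmap_tsum.
pose Z c := tact (HS_val E)^-1%g (psi i * P c).
have ZS c w : (mdeg w < mdeg c)%N -> Z c w = 0.
  by apply: tact_small => v; apply: mul_small_r; apply: substmap_tmon_summable.
have nablaZ c : tmap nabla (trunc Omega (fun w => Z c w *: HS_pd i D c)) =
    tmap iota (Z c) * tconst Omega (nabla (HS_pd i D c)).
  apply: tseriesP => w Ow; rewrite coefMc !coef_tmap trunc_in //.
  by have := LR_linear LR (Z c w) (HS_pd i D c) 0; rewrite raddf0 !addr0.
rewrite tsum_mull => [|c w]; last by rewrite -mulrA; apply: tmap_substmapM_small.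
rewrite [RHS]tsum_mull => [|c w wc]; last first.
  by rewrite nablaZ; apply: mul_small_l wc => v /ZS vZ; rewrite coef_tmap vZ raddf0.
apply: eq_tsum => c; rewrite nablaZ !mulrA coef_tmap; congr (_ * _).
rewrite subst_act_comm // -tactM -useries_mulE mulgV tact1 rmorphM //.
Qed.

End SubstSol.

(** * Lifting to N^p and the HS-structure *)

Section Restrict.
Variables (p : nat) (Delta : coideal p).

Definition restrict (M : nmodType) (r : tseries (full p) M) : tseries Delta M :=
  trunc Delta (coef r).

Lemma restrictE (M : nmodType) (r : tseries (full p) M) a :
  Delta a -> restrict r a = r a.
Proof. exact: trunc_in. Qed.

Definition ext (M : nmodType) (r : tseries Delta M) : tseries (full p) M :=
  trunc (full p) (coef r).

Lemma extE (M : nmodType) (r : tseries Delta M) a : ext r a = r a.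
Proof. exact: trunc_in. Qed.

Lemma restrict_is_zmod (M : zmodType) : zmod_morphism (@restrict M).
Proof.
by move=> r s; apply: tseriesP => a Da; rewrite coefB !restrictE // coefB.
Qed.
HB.instance Definition _ (M : zmodType) :=
  GRing.isZmodMorphism.Build (tseries (full p) M) (tseries Delta M) (@restrict M)
    (@restrict_is_zmod M).

Lemma restrict_is_monoid (R : pzRingType) : monoid_morphism (@restrict R).
Proof.
split=> [|r s]; apply: tseriesP => a Da; rewrite restrictE //.
  by rewrite !coef1.
rewrite !coefM //; apply: eq_msum => b c aE.
by rewrite !restrictE //; [exact: coideal_addr aE Da | exact: coideal_addl aE Da].
Qed.
HB.instance Definition _ (R : pzRingType) :=
  GRing.isMonoidMorphism.Build (tseries (full p) R) (tseries Delta R) (@restrict R)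
    (@restrict_is_monoid R).

Lemma restrict_chi (M : zmodType) (r : tseries (full p) M) :
  restrict (chi r) = chi (restrict r).
Proof.
by apply: tseriesP => a Da; rewrite coef_chi !restrictE // coef_chi.
Qed.

Lemma restrict_tmap (M N : zmodType) (f : {additive M -> N})
    (r : tseries (full p) M) :
  restrict (tmap f r) = tmap f (restrict r).
Proof.
by apply: tseriesP => a Da; rewrite coef_tmap !restrictE // coef_tmap.
Qed.

Lemma restrict_ext (M : nmodType) (r : tseries Delta M) : restrict (ext r) = r.
Proof. by apply: tseriesP => a Da; rewrite restrictE // extE. Qed.

Lemma restrict_tmon (R : pzRingType) a :
  restrict (tmon (full p) R a) = tmon Delta R a.
Proof. by apply: tseriesP => b Db; rewrite restrictE // !trunc_in. Qed.

Variables (q : nat) (Omega : coideal q) (A : comPzRingType).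
Variable phi : substmap Delta Omega A.

Fact ext_subst_alg x :
  (phi \o @restrict A) (tconst (full p) x) = tconst Omega x.
Proof.
rewrite /= -(substmap_alg phi); congr (phi _).
by apply: tseriesP => a Da; rewrite restrictE // !coef_const.
Qed.

Fact ext_subst_var i : (phi \o @restrict A) (tvar (full p) A i) 0%MM = 0.
Proof. by rewrite /= [restrict _]restrict_tmon substmap_var. Qed.

Definition ext_subst := SubstMap ext_subst_alg ext_subst_var.

(** Monomials outside $\Delta$ truncate to 0, so the coefficients of $r$ there do not contribute. *)
Lemma ext_subst_act (R : pzRingType) (iota : {rmorphism A -> R}) r :
  subst_act iota ext_subst r = subst_act iota phi (restrict r).
Proof.
apply: tseriesP => w Ow; rewrite !trunc_in //; apply: eq_bigr => a _.
rewrite /= restrict_tmon.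
have [Da|nDa] := pselect (Delta a); first by rewrite restrictE.
have -> : tmon Delta A a = 0.
  apply: tseriesP => b Db; rewrite coef0 trunc_in //.
  by case: eqP => // ba; case: nDa; rewrite -ba.
by rewrite rmorph0 coef0 rmorph0 !mul0r.
Qed.

End Restrict.

Section Lift.
Variables (k A : comPzRingType) (eta : {rmorphism k -> A}).
Variable ratE : {rmorphism rat -> kend eta}.

(** The case $R = \mathrm{End}_k(A)$, $r = D$ of [sol_subst], where $\varphi \bullet r$ is $\varphi
    \bullet D$. *)
Lemma HS_eps_subst p q (Omega : coideal q) (phi : substmap (full p) Omega A)
    (D : HS eta (full p)) : HS_eps (HS_subst phi D) = subst_eps phi D.
Proof.
apply: (@tmap_inj _ _ _ _ (@der_end k A eta)); first exact: derP.
have := sol_subst phi ratE (LR_kmult eta) (useries_at0 (HS_val D)) (chi_HS D).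
move=> H; rewrite -(@eps_eq _ _ _ (HS_val (HS_subst phi D)) _ H).
by apply: tseriesP => a _; rewrite coef_tmap.
Qed.

Variables (p : nat) (Delta : coideal p).

Section HSofEps.
Variable delta : tseries Delta (derivation eta).
Hypothesis delta0 : delta 0%MM = 0.

Let y := tmap (@der_end k A eta) delta.
Let y0 : y 0%MM = 0. Proof. by rewrite coef_tmap delta0 raddf0. Qed.

Definition HS_of_eps_val := USeries (ode_sol_at0 ratE y).

(** With both series of [sol_comm] equal to the solution $E$, it reads $E x = E(x) E$ for
    multiplication operators; evaluation at $z$ is the Leibniz rule. *)
Fact HS_of_eps_leibniz a : Delta a -> forall x z : A,
  HS_of_eps_val a (x * z) = msum a (fun b c => HS_of_eps_val b x * HS_of_eps_val c z).
Proof.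
move=> Da x z; have e0 := ode_sol_at0 ratE y; have eP := ode_solP ratE y0.
have := sol_comm ratE (LR_kmult eta) delta0 e0 e0 eP eP (tconst Delta x).
move/(congr1 (fun u : tseries Delta (kend eta) => u a z)).
rewrite tmap_const coefMc kendME /= => ->; rewrite coefM // kend_sumE.
by apply: eq_bigr => h _; rewrite coef_tmap kendME /= tact_const.
Qed.

Definition HS_of_eps := MkHS HS_of_eps_leibniz.

Lemma HS_of_epsK : HS_eps HS_of_eps = delta.
Proof.
apply: (@tmap_inj _ _ _ _ (@der_end k A eta)); first exact: derP.
have H : chi HS_of_eps = useries_val HS_of_eps * y := ode_solP ratE y0.
by rewrite -[RHS]/y -(eps_eq H); apply: tseriesP => a _; rewrite coef_tmap.
Qed.

End HSofEps.
End Lift.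

(** * Integrating the image of $\varepsilon(D)$ in $R$ *)

Section Integrate.
Variables (k A : comPzRingType) (eta : {rmorphism k -> A}).
Variables (R : pzRingType) (ratR : {rmorphism rat -> R}).
Variable nabla : {additive derivation eta -> R}.

Definition LR_HS : HS_system eta R := fun p Delta D =>
  USeries (ode_sol_at0 ratR (tmap nabla (HS_eps D))).

Lemma tmap_eps0 p (Delta : coideal p) (D : HS eta Delta) :
  tmap nabla (HS_eps D) 0%MM = 0.
Proof. by rewrite coef_tmap HS_eps_at0 raddf0. Qed.

Lemma chi_LR_HS p (Delta : coideal p) (D : HS eta Delta) :
  chi (LR_HS D) = useries_val (LR_HS D) * tmap nabla (HS_eps D).
Proof. exact/ode_solP/tmap_eps0. Qed.

Lemma LR_HS_uniq p (Delta : coideal p) (D : HS eta Delta) (r : tseries Delta R) :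
  r 0%MM = 1 -> chi r = r * tmap nabla (HS_eps D) -> r = LR_HS D.
Proof.
move=> r0 rE; apply: (ode_uniq ratR (tmap_eps0 D)) rE (chi_LR_HS D).
by rewrite r0 useries_at0.
Qed.

End Integrate.

Section HSStructure.
Variables (k A : comPzRingType) (eta : {rmorphism k -> A}).
Variable ratE : {rmorphism rat -> kend eta}.
Variables (R : pzRingType) (ratR : {rmorphism rat -> R}).
Variables (iota : {rmorphism A -> R}) (nabla : {additive derivation eta -> R}).
Hypothesis LR : LR_admissible iota nabla.

Let Psi := LR_HS ratR nabla.

(** Integrate the extension of $\varepsilon(D)$ by zero. Truncation respects products and [chi], so
    the truncated solutions solve the equations over $\Delta$. *)
Lemma HS_lift p (Delta : coideal p) (D : HS eta Delta) :
  exists2 L : HS eta (full p), restrict Delta (HS_val L) = HS_val D &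
     restrict Delta (Psi L) = Psi D.
Proof.
have d0 : ext (HS_eps D) 0%MM = 0 by rewrite extE HS_eps_at0.
pose L := HS_of_eps ratE d0.
have LE : HS_eps L = ext (HS_eps D) := HS_of_epsK ratE d0.
have chi_restrict (S : pzRingType) (f : {additive derivation eta -> S}) r :
    chi r = r * tmap f (HS_eps L) ->
    chi (restrict Delta r) = restrict Delta r * tmap f (HS_eps D).
  by move=> rE; rewrite -restrict_chi rE rmorphM /= restrict_tmap LE restrict_ext.
have D0 := coideal0 Delta.
exists L.
  apply: (ode_uniq ratE (tmap_eps0 (@der_end k A eta) D)); last exact: chi_HS.
    by rewrite restrictE // !useries_at0.
  exact/chi_restrict/chi_HS.
apply: LR_HS_uniq; first by rewrite restrictE ?useries_at0.
exact/chi_restrict/chi_LR_HS.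
Qed.

Lemma LR_HS_mul p (Delta : coideal p) (D E : HS eta Delta) :
  Psi (D * E)%g = (Psi D * Psi E)%g.
Proof.
apply: useriesP; rewrite useries_mulE; symmetry; apply: LR_HS_uniq.
  exact: umul_subproof.
by apply: (sol_mul ratR LR); rewrite ?useries_at0 //; apply: chi_LR_HS.
Qed.

Lemma LR_HS_comm p (Delta : coideal p) (D : HS eta Delta) a :
  useries_val (Psi D) * tconst Delta (iota a) =
  tmap iota (HS_eval D a) * useries_val (Psi D).
Proof.
rewrite HS_evalE -tmap_const.
apply: (sol_comm ratR LR (HS_eps_at0 D)); rewrite ?useries_at0 //.
  exact: chi_HS.
exact: chi_LR_HS.
Qed.

Lemma LR_HS_subst p q (Delta : coideal p) (Omega : coideal q)
    (phi : substmap Delta Omega A) (D : HS eta Delta) :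
  useries_val (Psi (HS_subst phi D)) = subst_act iota phi (Psi D).
Proof.
have [L LD LPsi] := HS_lift D; rewrite -LPsi -ext_subst_act.
have <- : HS_subst (ext_subst phi) L = HS_subst phi D.
  by apply/HSP/useriesP; rewrite /= ext_subst_act LD.
symmetry; apply: LR_HS_uniq; first by rewrite subst_act_at0 useries_at0.
rewrite (HS_eps_subst ratE).
by apply: (sol_subst _ ratR LR); rewrite ?useries_at0 //; apply: chi_LR_HS.
Qed.

(** In $|a| \Psi(D)_a$ the non-zero terms have a right factor from $R_1$ and a left factor of degree
    $|b| < |a|$, hence lie in $R_{|b|+1} \subset R_{|a|}$. The inverse of $|a|$ is taken in $A$,
    whose image lies in $R_0$. *)
Lemma LR_HS_filtered (ratA : {rmorphism rat -> A}) (F : nat -> set R) :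
  is_filtration iota F -> (forall d, F 1%N (nabla d)) -> filtered_HS F Psi.
Proof.
move=> filtF nablaF p Delta D a Da; have F0 d := filt0 filtF d.
have FD d x y : F d x -> F d y -> F d (x + y).
  move=> Fx Fy; rewrite -[y]opprK; apply: (filtB filtF) => //.
  by rewrite -sub0r; apply: (filtB filtF).
have Fincr d e x : (d <= e)%N -> F d x -> F e x.
  by move=> /subnK <-; elim: (e - d)%N => // n IHn /IHn; apply: (filt_incr filtF).
have [n] := ubnP (mdeg a); elim: n a Da => // n IHn a Da; rewrite ltnS => an.
have [->|a0] := eqVneq a 0%MM.
  by rewrite useries_at0 mdeg0 -(rmorph1 iota); apply: (filt_iota filtF).
have ma : (0 < mdeg a)%N by rewrite lt0n mdeg_eq0.
have -> : Psi D a = iota (ratA (mdeg a)%:R^-1) * (chi (Psi D)) a.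
  apply: (rat_mulIn ratR ma); rewrite coef_chi.
  by rewrite (rat_divnK (iota \o ratA) _ ma).
rewrite -[mdeg a]add0n; apply: (filtM filtF); first exact: filt_iota.
rewrite chi_LR_HS coefM // /msum.
apply: (big_ind (F (mdeg a))) => [|x y|h /eqP aE]; [exact: F0 | exact: FD |].
rewrite coef_tmap; have [h0|h0] := eqVneq (h.2 : 'X_{1..p}) 0%MM.
  by rewrite h0 HS_eps_at0 raddf0 mulr0.
have lt : (mdeg h.1 < mdeg a)%N.
  by apply: (@mdeg_lt_addl _ (mdeg a) a h.2 h.1); rewrite // addmC.
apply: (Fincr (mdeg h.1 + 1)%N); first by rewrite addn1.
apply: (filtM filtF) => //; apply: IHn; first exact: coideal_addl aE Da.
exact: leq_trans lt an.
Qed.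

End HSStructure.

Theorem theorem2p2p5 (k : comPzRingType)
  (ratk : {rmorphism rat -> k}) (ratk_inj : injective ratk)
  (A : comPzRingType) (eta : {rmorphism k -> A})
  (R : pzRingType) (etaR : {rmorphism k -> R})
  (etaR_central : forall (c : k) (r : R), etaR c * r = r * etaR c)
  (iota : {rmorphism A -> R}) (iota_alg : forall c : k, iota (eta c) = etaR c)
  (nabla : derivation eta -> R) (nabla_LR : LR_admissible iota nabla) :
  exists Psi : HS_system eta R,
    unique (fun Psi' : HS_system eta R =>
      is_HS_structure iota Psi' /\
      (forall (p : nat) (Delta : coideal p) (D : HS eta Delta), (1 <= p)%N ->
         eps (Psi' p Delta D) = tmap nabla (HS_eps D))) Psi /\
    (forall F : nat -> set R, is_filtration iota F ->
       (forall d : derivation eta, F 1%N (nabla d)) -> filtered_HS F Psi).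
Proof.
pose ratR : {rmorphism rat -> R} := iota \o (eta \o ratk).
pose ratE : {rmorphism rat -> kend eta} := kmult eta \o (eta \o ratk).
have nabla0 : zmod_morphism nabla.
  move=> d d'; have := LR_linear nabla_LR (- 1) d' d.
  by rewrite scaleN1r rmorphN1 mulN1r addrC => ->; rewrite addrC.
pose nablaA : {additive derivation eta -> R} :=
  HB.pack nabla (GRing.isZmodMorphism.Build _ _ nabla nabla0).
have LR : LR_admissible iota nablaA by [].
exists (LR_HS ratR nablaA); split; [split; [split|] |].
- split; [exact: (LR_HS_mul ratR LR) | exact: (LR_HS_comm ratR LR) |].
  exact: (LR_HS_subst ratE ratR LR).
- by move=> p Delta D _; apply/eps_eq/chi_LR_HS.
- move=> Psi' [_ Psi'E]; apply: functional_extensionality_dep => p.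
  apply: functional_extensionality_dep => Delta.
  apply: functional_extensionality_dep => D; apply: useriesP.
  (* For $p = 0$ the only multi-index is 0, where both series have coefficient 1; the equation for
     [eps] is available when $p \ge 1$. *)
  case: p Delta D => [|p] Delta D.
    apply: tseriesP => a _; have -> : a = 0%MM by apply/mnmP => -[].
    by rewrite !useries_at0.
  symmetry; apply: (LR_HS_uniq ratR (nabla := nablaA)); first exact: useries_at0.
  by rewrite chi_eps Psi'E.
- move=> F filtF F1.
  exact: (@LR_HS_filtered _ _ _ _ ratR iota nablaA (eta \o ratk) F filtF F1).
Qed.
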